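(* Every left fibration of simplicial sets is proper, and every right fibration of simplicial sets is smooth.
   Context: A right fibration of simplicial sets is a map with the right lifting property against the horn inclusions $\Lambda^n_k\to\Delta^n$, $n\ge1$, $0<k\le n$; a left fibration is a map with the right lifting property against $\Lambda^n_k\to\Delta^n$, $n\geq 1$, $0\le k<n$. For a simplicial set $A$, $\mathbf{RFib}(A)$ (the Contravariant model structure) is the unique model structure on $\mathbf{sSet}/A$ with cofibrations the monomorphisms and fibrant objects the right fibrations with target $A$; $\mathbf{LFib}(A)$ (the Covariant model structure) is the unique model structure with cofibrations the monomorphisms and fibrant objects the left fibrations with target $A$. A map $f\colon X\to Y$ of simplicial sets is final if for every simplicial set $A$ and every map $Y\to A$, $f$ regarded as a map over $A$ is a weak equivalence in $\mathbf{RFib}(A)$; it is initial if for all such $A$ and $Y\to A$ it is a weak equivalence in $\mathbf{LFib}(A)$. A map $p\colon X\to Y$ is proper if for every diagram $$\begin{array}{ccccc}A'&\xrightarrow{w}&B'&\to&X\\ \downarrow&&\downarrow&&\downarrow p\\ A&\xrightarrow{v}&B&\to&Y\end{array}$$ with both squares cartesian, $w$ is final whenever $v$ is final. It is smooth if in every such diagram $w$ is initial whenever $v$ is initial. *)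

(* Defs.v *)
From HB Require Import structures.
From mathcomp Require Import all_boot.
From mathcomp Require Import boolp.

Set Implicit Arguments.
Unset Strict Implicit.
Unset Printing Implicit Defensive.

Record category := Category {
  ob :> Type;
  hom : ob -> ob -> Type;
  idm : forall X, hom X X;
  comp : forall X Y Z, hom Y Z -> hom X Y -> hom X Z;
  comp_idl : forall X Y (f : hom X Y), comp (idm Y) f = f;
  comp_idr : forall X Y (f : hom X Y), comp f (idm X) = f;
  comp_assoc : forall X Y Z T (f : hom X Y) (g : hom Y Z) (h : hom Z T),
    comp h (comp g f) = comp (comp h g) f
}.

Arguments hom {c} X Y.
Arguments idm {c} X.
Arguments comp {c X Y Z} g f.

Declare Scope cat_scope.
Delimit Scope cat_scope with cat.
Notation "g ∘ f" := (comp g f) (at level 40, left associativity) : cat_scope.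
Local Open Scope cat_scope.

Section CategoryNotions.
Variable C : category.

Definition monic (X Y : C) (f : hom X Y) : Prop :=
  forall (Z : C) (g h : hom Z X), f ∘ g = f ∘ h -> g = h.

Definition is_terminal (T : C) : Prop :=
  forall X : C, exists f : hom X T, forall g : hom X T, g = f.

(** [p] has the right lifting property against [i]. *)
Definition rlp (A B X Y : C) (i : hom A B) (p : hom X Y) : Prop :=
  forall (u : hom A X) (v : hom B Y), p ∘ u = v ∘ i ->
  exists h : hom B X, h ∘ i = u /\ p ∘ h = v.

(** The following square is cartesian:
<<
        g'
     P ----> X
  f' |       | f
     v       v
     Y ----> Z
         g
>> *)
Definition cartesian (P X Y Z : C)
    (g' : hom P X) (f' : hom P Y) (f : hom X Z) (g : hom Y Z) : Prop :=
  f ∘ g' = g ∘ f' /\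
  forall (T : C) (a : hom T X) (b : hom T Y), f ∘ a = g ∘ b ->
  exists h : hom T P, (g' ∘ h = a /\ f' ∘ h = b) /\
    forall h' : hom T P, g' ∘ h' = a -> f' ∘ h' = b -> h' = h.

(** [f] is a retract of [g] in the category of arrows. *)
Definition retract (X Y X' Y' : C) (f : hom X Y) (g : hom X' Y') : Prop :=
  exists (s : hom X X') (r : hom X' X) (s' : hom Y Y') (r' : hom Y' Y),
    [/\ r ∘ s = idm X, r' ∘ s' = idm Y, g ∘ s = s' ∘ f & f ∘ r = r' ∘ g].

Definition morphism_class := forall X Y : C, hom X Y -> Prop.

Definition retract_closed (K : morphism_class) : Prop :=
  forall (X Y X' Y' : C) (f : hom X Y) (g : hom X' Y'),
    retract f g -> K X' Y' g -> K X Y f.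

(** Quillen's closed model structures, with factorizations not required to be
    functorial.  The existence of limits and colimits is a property of the
    underlying category and is not part of the record. *)
Record model_structure := ModelStructure {
  weq : morphism_class;
  cof : morphism_class;
  fib : morphism_class;
  weq_comp : forall (X Y Z : C) (f : hom X Y) (g : hom Y Z),
    weq f -> weq g -> weq (g ∘ f);
  weq_cancel_l : forall (X Y Z : C) (f : hom X Y) (g : hom Y Z),
    weq g -> weq (g ∘ f) -> weq f;
  weq_cancel_r : forall (X Y Z : C) (f : hom X Y) (g : hom Y Z),
    weq f -> weq (g ∘ f) -> weq g;
  weq_retract : retract_closed weq;
  cof_retract : retract_closed cof;
  fib_retract : retract_closed fib;
  lift_tcof_fib : forall (A B X Y : C) (i : hom A B) (p : hom X Y),
    cof i -> weq i -> fib p -> rlp i p;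
  lift_cof_tfib : forall (A B X Y : C) (i : hom A B) (p : hom X Y),
    cof i -> fib p -> weq p -> rlp i p;
  factor_tcof_fib : forall (X Y : C) (f : hom X Y),
    exists (Z : C) (i : hom X Z) (p : hom Z Y),
      [/\ cof i, weq i, fib p & p ∘ i = f];
  factor_cof_tfib : forall (X Y : C) (f : hom X Y),
    exists (Z : C) (i : hom X Z) (p : hom Z Y),
      [/\ cof i, fib p, weq p & p ∘ i = f]
}.

Definition fibrant (M : model_structure) (X : C) : Prop :=
  forall (T : C) (f : hom X T), is_terminal T -> fib M f.

End CategoryNotions.

Section Slice.
Variables (C : category) (A : C).

Record slice_ob := SliceOb { total : C; proj : hom total A }.

Record slice_hom (X Y : slice_ob) := SliceHom {
  slice_map : hom (total X) (total Y);
  slice_mapP : proj Y ∘ slice_map = proj X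
}.

Lemma slice_hom_ext X Y (f g : slice_hom X Y) :
  slice_map f = slice_map g -> f = g.
Proof.
case: f g => [f hf] [g hg] /= efg; subst g.
by rewrite (Prop_irrelevance hf hg).
Qed.

Definition slice_id X : slice_hom X X := SliceHom (comp_idr (proj X)).

Lemma slice_comp_subproof X Y Z (g : slice_hom Y Z) (f : slice_hom X Y) :
  proj Z ∘ (slice_map g ∘ slice_map f) = proj X.
Proof. by rewrite comp_assoc !slice_mapP. Qed.

Definition slice_comp X Y Z (g : slice_hom Y Z) (f : slice_hom X Y) :
  slice_hom X Z := SliceHom (slice_comp_subproof g f).

Definition slice : category.
Proof.
refine (@Category slice_ob slice_hom slice_id slice_comp _ _ _).
- by move=> X Y f; apply: slice_hom_ext; apply: comp_idl.
- by move=> X Y f; apply: slice_hom_ext; apply: comp_idr.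
- by move=> X Y Z T f g h; apply: slice_hom_ext; apply: comp_assoc.
Defined.

Lemma slice_terminal : is_terminal (SliceOb (idm A) : slice).
Proof.
move=> X; exists (@SliceHom X (SliceOb (idm A)) (proj X) (comp_idl _)) => g.
by apply: slice_hom_ext; rewrite /= -(slice_mapP g) /= comp_idl.
Qed.

(** The map [f : X -> Y], regarded as a map over [A] by means of
    [q : Y -> A]. *)
Definition map_over (X Y : C) (f : hom X Y) (q : hom Y A) :
  @hom slice (SliceOb (q ∘ f)) (SliceOb q) :=
  @SliceHom (SliceOb (q ∘ f)) (SliceOb q) f erefl.

End Slice.

(** Order-preserving maps [m] -> [n], where the ordinal [n] = {0 < ... < n} is
    ['I_n.+1]. *)
Record mono_map (m n : nat) := MonoMap {
  mono_fun :> {ffun 'I_m.+1 -> 'I_n.+1};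
  _ : [forall i : 'I_m.+1, forall j : 'I_m.+1,
        (i <= j) ==> (mono_fun i <= mono_fun j)]
}.

HB.instance Definition _ m n := [isSub for @mono_fun m n].

Lemma mono_mapP m n (f : mono_map m n) (i j : 'I_m.+1) : i <= j -> f i <= f j.
Proof. by case: f => f /= /forallP/(_ i)/forallP/(_ j)/implyP; apply. Qed.

Lemma mono_id_subproof n : [forall i : 'I_n.+1, forall j : 'I_n.+1,
  (i <= j) ==> ([ffun k : 'I_n.+1 => k] i <= [ffun k : 'I_n.+1 => k] j)].
Proof. by apply/forallP=> i; apply/forallP=> j; rewrite !ffunE; apply/implyP. Qed.

Definition mono_id n : mono_map n n := MonoMap (mono_id_subproof n).

Lemma mono_comp_subproof l m n (g : mono_map m n) (f : mono_map l m) :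
  [forall i : 'I_l.+1, forall j : 'I_l.+1,
    (i <= j) ==> ([ffun k => g (f k)] i <= [ffun k => g (f k)] j)].
Proof.
apply/forallP=> i; apply/forallP=> j; apply/implyP=> lij.
by rewrite !ffunE; do 2!apply: mono_mapP.
Qed.

Definition mono_comp l m n (g : mono_map m n) (f : mono_map l m) :
  mono_map l n := MonoMap (mono_comp_subproof g f).

Lemma mono_compE l m n (g : mono_map m n) (f : mono_map l m) i :
  mono_comp g f i = g (f i).
Proof. by rewrite ffunE. Qed.

Lemma mono_ext m n (f g : mono_map m n) : (forall i, f i = g i) -> f = g.
Proof. by move=> efg; apply: val_inj; apply/ffunP. Qed.

Record simplicial_set := SimplicialSet {
  simplex :> nat -> Type;
  act : forall m n, mono_map m n -> simplex n -> simplex m;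
  act_id : forall n (x : simplex n), act (mono_id n) x = x;
  act_comp : forall l m n (g : mono_map m n) (f : mono_map l m) (x : simplex n),
    act (mono_comp g f) x = act f (act g x)
}.

Record simplicial_map (X Y : simplicial_set) := SimplicialMap {
  smap :> forall n, X n -> Y n;
  smap_act : forall m n (f : mono_map m n) (x : X n),
    smap (act f x) = act f (smap x)
}.

Lemma simplicial_map_ext X Y (f g : simplicial_map X Y) :
  (forall n (x : X n), f n x = g n x) -> f = g.
Proof.
case: f g => [f hf] [g hg] /= efg.
have {}efg : f = g.
  by apply: functional_extensionality_dep => n; apply: funext => x.
by subst g; rewrite (Prop_irrelevance hf hg).
Qed.

Definition simplicial_id X : simplicial_map X X :=
  @SimplicialMap X X (fun n x => x) (fun _ _ _ _ => erefl).

Lemma simplicial_comp_subproof X Y Z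
    (g : simplicial_map Y Z) (f : simplicial_map X Y) m n (a : mono_map m n) x :
  g m (f m (act a x)) = act a (g n (f n x)).
Proof. by rewrite !smap_act. Qed.

Definition simplicial_comp X Y Z
    (g : simplicial_map Y Z) (f : simplicial_map X Y) : simplicial_map X Z :=
  @SimplicialMap X Z (fun n x => g n (f n x)) (simplicial_comp_subproof g f).

Definition sSet : category.
Proof.
refine (@Category simplicial_set simplicial_map
          simplicial_id simplicial_comp _ _ _).
- by move=> X Y f; apply: simplicial_map_ext.
- by move=> X Y f; apply: simplicial_map_ext.
- by move=> X Y Z T f g h; apply: simplicial_map_ext.
Defined.

Definition std_simplex (n : nat) : sSet.
Proof.
refine (@SimplicialSet (fun m => mono_map m n)
          (fun l m f x => mono_comp x f) _ _).
- by move=> m x; apply: mono_ext => i; rewrite mono_compE ffunE.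
- by move=> l m p g f x; apply: mono_ext => i; rewrite !mono_compE.
Defined.

(** A simplex of [std_simplex n] lies in the horn when it lies in the face
    opposite to some vertex [j != k]. *)
Definition in_horn (n : nat) (k : 'I_n.+1) (m : nat) (x : mono_map m n) : bool :=
  [exists j : 'I_n.+1, (j != k) && [forall i : 'I_m.+1, x i != j]].

Lemma in_horn_act n (k : 'I_n.+1) l m (f : mono_map l m) (x : mono_map m n) :
  in_horn k x -> in_horn k (mono_comp x f).
Proof.
case/existsP=> j /andP[njk /forallP xj]; apply/existsP; exists j.
by rewrite njk; apply/forallP=> i; rewrite mono_compE.
Qed.

Definition horn (n : nat) (k : 'I_n.+1) : sSet.
Proof.
refine (@SimplicialSet (fun m => {x : mono_map m n | in_horn k x})
  (fun l m f x => exist _ (mono_comp (val x) f) (in_horn_act f (valP x))) _ _).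
- by move=> m x; apply: val_inj; apply: (@act_id (std_simplex n)).
- by move=> l m p g f x; apply: val_inj; apply: (@act_comp (std_simplex n)).
Defined.

Definition horn_incl (n : nat) (k : 'I_n.+1) : @hom sSet (horn k) (std_simplex n) :=
  @SimplicialMap (horn k) (std_simplex n) (fun m x => val x)
    (fun _ _ _ _ => erefl).

Definition right_fibration (X Y : sSet) (p : hom X Y) : Prop :=
  forall (n : nat) (k : 'I_n.+1), 1 <= n -> 0 < k -> rlp (horn_incl k) p.

Definition left_fibration (X Y : sSet) (p : hom X Y) : Prop :=
  forall (n : nat) (k : 'I_n.+1), 1 <= n -> k < n -> rlp (horn_incl k) p.

(** A model structure is determined by its cofibrations and fibrant objects,
    so each of these records has, up to the classes of maps it defines, at most
    one inhabitant. *)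

Record contravariant_model (A : sSet) := ContravariantModel {
  contra_model :> model_structure (slice A);
  contra_cof : forall (X Y : slice A) (f : hom X Y),
    cof contra_model f <-> monic f;
  contra_fibrant : forall X : slice A,
    fibrant contra_model X <-> right_fibration (proj X)
}.

Record covariant_model (A : sSet) := CovariantModel {
  cov_model :> model_structure (slice A);
  cov_cof : forall (X Y : slice A) (f : hom X Y),
    cof cov_model f <-> monic f;
  cov_fibrant : forall X : slice A,
    fibrant cov_model X <-> left_fibration (proj X)
}.

Section FinalProper.
Variable RFib : forall A : sSet, contravariant_model A.

Definition final (X Y : sSet) (f : hom X Y) : Prop :=
  forall (A : sSet) (q : hom Y A), weq (RFib A) (map_over f q).

Definition proper (X Y : sSet) (p : hom X Y) : Prop :=
  forall (A' B' A B : sSet) (w : hom A' B') (x : hom B' X)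
    (a : hom A' A) (b : hom B' B) (v : hom A B) (y : hom B Y),
    cartesian w a b v -> cartesian x b p y -> final v -> final w.

End FinalProper.

Section InitialSmooth.
Variable LFib : forall A : sSet, covariant_model A.

Definition initial (X Y : sSet) (f : hom X Y) : Prop :=
  forall (A : sSet) (q : hom Y A), weq (LFib A) (map_over f q).

Definition smooth (X Y : sSet) (p : hom X Y) : Prop :=
  forall (A' B' A B : sSet) (w : hom A' B') (x : hom B' X)
    (a : hom A' A) (b : hom B' B) (v : hom A B) (y : hom B Y),
    cartesian w a b v -> cartesian x b p y -> initial v -> initial w.

End InitialSmooth.

(* Main.v *)
(** Write [e]-fibration for right ([e = true]) or left ([e = false]) fibration.

    Filling prisms one simplex at a time shows that [e]-fibrations lift against
    the pushout products of [{e} -> Delta^1] with all monomorphisms, hence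
    against every subobject [S] of [T] onto which [T] retracts by a deformation
    preserving [S], the identity at the end [~~ e] of the interval.  For example
    a horn of [Delta^n], of the kind that defines [e]-fibrations, is such a
    subobject of [Delta^n].  As [~~ e]-fibrations lift homotopies from the end
    [~~ e], the deformation lifts to any [~~ e]-fibration over [Delta^n], and
    the preimage of the horn is again of this form.
    Dependent products along a [~~ e]-fibration [b] therefore preserve
    [e]-fibrations, and by adjunction the base change along [b] of a map with
    the left lifting property against [e]-fibrations still has this property.

    A final map [v : A -> B] factors in [RFib(B)] as [i] followed by a trivial
    fibration [pi].  By a homotopy over [B], the map [i] lifts against right
    fibrations over the middle term.  The base change of [pi] is a trivial
    fibration, and that of [i] allows extensions of maps and of homotopies into
    all fibrant objects, which makes it a weak equivalence in every [RFib(C)]. *)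

From mathcomp Require Import all_boot zify.
From mathcomp Require Import boolp classical_sets.
Require Import Defs.

Set Implicit Arguments.
Unset Strict Implicit.
Unset Printing Implicit Defensive.

Local Open Scope cat_scope.

(** * Monotone maps, simplicial sets and partial maps *)

Section MonotoneMaps.

Lemma mk_mono_subproof m n (F : 'I_m.+1 -> 'I_n.+1) :
  (forall i j : 'I_m.+1, i <= j -> F i <= F j) ->
  [forall i : 'I_m.+1, forall j : 'I_m.+1,
    (i <= j) ==> ([ffun k => F k] i <= [ffun k => F k] j)].
Proof.
move=> mF; apply/forallP=> i; apply/forallP=> j; apply/implyP.
by rewrite !ffunE; apply: mF.
Qed.

Definition mk_mono m n F mF : mono_map m n := MonoMap (@mk_mono_subproof m n F mF).

Lemma mk_monoE m n F mF i : @mk_mono m n F mF i = F i.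
Proof. by rewrite ffunE. Qed.

Lemma mono_idE n i : mono_id n i = i.
Proof. by rewrite ffunE. Qed.

Lemma nat_mono m n (F : 'I_m.+1 -> nat) :
  (forall i, F i <= n) -> (forall i j : 'I_m.+1, i <= j -> F i <= F j) ->
  exists f : mono_map m n, forall i, f i = F i :> nat.
Proof.
move=> bF mF; have mF' (i j : 'I_m.+1) : i <= j ->
  (inord (F i) : 'I_n.+1) <= (inord (F j) : 'I_n.+1).
  by move=> lij; rewrite !inordK ?ltnS ?bF ?mF.
by exists (mk_mono mF') => i; rewrite mk_monoE inordK ?ltnS.
Qed.

Lemma const_subproof m n (k : 'I_n.+1) (i j : 'I_m.+1) : i <= j -> k <= k.
Proof. by []. Qed.

Definition mono_const m n (k : 'I_n.+1) : mono_map m n :=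
  mk_mono (@const_subproof m n k).

(** The vertex is a natural number, which leaves side conditions on faces to linear arithmetic. *)
Definition avoids m n (f : mono_map m n) (j : nat) : Prop :=
  forall i, f i <> j :> nat.

Definition surj m n (f : mono_map m n) : Prop := forall j, exists i, f i = j.

Lemma not_surj m n (f : mono_map m n) : ~ surj f <-> exists2 j, j <= n & avoids f j.
Proof.
split=> [/existsNP[j nj]|[j lj aj] /(_ (inord j))[i fij]].
  exists j => [|i /ord_inj fij]; first by rewrite -ltnS.
  by apply: nj; exists i.
by apply: (aj i); rewrite fij inordK.
Qed.

(** Any set-theoretic section of a monotone surjection is monotone, so its value at [f a] may be
    prescribed. *)
Lemma surj_mono_section m n (f : mono_map m n) a :
  surj f -> exists t : mono_map n m, (forall j, f (t j) = j) /\ t (f a) = a.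
Proof.
move=> sf.
have [t tP] := choice (fun j => sf j).
pose t' j := if j == f a then a else t j.
have ft' j : f (t' j) = j by rewrite /t'; case: eqP => [->|_].
have mt' (i j : 'I_n.+1) : i <= j -> t' i <= t' j.
  move=> lij; rewrite leqNgt; apply/negP => lt.
  have := mono_mapP f (ltnW lt); rewrite !ft' => lji.
  have eij : i = j by apply: ord_inj; apply/eqP; rewrite eqn_leq lij lji.
  by move: lt; rewrite eij ltnn.
exists (mk_mono mt'); split=> [j|]; rewrite mk_monoE //.
by rewrite /t' eqxx.
Qed.

Lemma surj_mono_endo n (c : mono_map n n) : surj c -> c = mono_id n.
Proof.
move=> sc; apply: mono_ext => i; rewrite mono_idE; apply: ord_inj.
(* Upward induction gives [c j <= j]; downward induction, on [n - j], gives the reverse. *)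
have le1 k (j : 'I_n.+1) : j = k :> nat -> c j <= k.
  elim: k j => [|k IH] j ejk.
    have [a ca] := sc ord0.
    have := @mono_mapP _ _ c j a; rewrite ejk => /(_ isT).
    by rewrite ca.
  rewrite leqNgt; apply/negP => lt.
  have lk : k < n.+1 by have := ltn_ord j; lia.
  have [a ca] := sc j.
  have [laj|lja] := leqP j a.
    by have := mono_mapP c laj; rewrite ca; lia.
  have := @mono_mapP _ _ c a (Ordinal lk).
  have /= := IH (Ordinal lk) erefl; rewrite ca ejk; lia.
have le2 k (j : 'I_n.+1) : n - j = k -> j <= c j.
  elim: k j => [|k IH] j ejk.
    have [a ca] := sc ord_max.
    have := @mono_mapP _ _ c a j; rewrite ca /=.
    by have := ltn_ord a; have := ltn_ord j; lia.
  rewrite leqNgt; apply/negP => lt.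
  have lk : j.+1 < n.+1 by lia.
  have [a ca] := sc j.
  have [laj|lja] := leqP a j.
    by have := mono_mapP c laj; rewrite ca; lia.
  have := @mono_mapP _ _ c (Ordinal lk) a.
  have /= := IH (Ordinal lk); rewrite ca; lia.
by have := le1 _ i erefl; have := le2 _ i erefl; lia.
Qed.

(** Collapsing with [unbump j] and then applying the coface [bump j] returns every vertex other than
    [j]. *)
Lemma avoids_factor m n (f : mono_map m n) j : j <= n -> avoids f j ->
  exists n' (d : mono_map n' n) (g : mono_map m n'),
    n' < n /\ f = mono_comp d g.
Proof.
move=> lj afj; case: n => [|n] in f lj afj *.
  by case: (afj ord0); have := ltn_ord (f ord0); lia.
have [d dE] : exists d : mono_map n n.+1, forall i, d i = bump j i :> nat.
  apply: nat_mono => [i|i i' lii']; last by rewrite leq_bump2.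
  by rewrite /bump; have := ltn_ord i; lia.
have [g gE] : exists g : mono_map m n, forall i, g i = unbump j (f i) :> nat.
  apply: nat_mono => [i|i i' /(mono_mapP f)]; rewrite /unbump.
    by have := ltn_ord (f i); have := afj i; lia.
  by have := afj i; have := afj i'; lia.
exists n, d, g; split=> //; apply: mono_ext => i; apply: ord_inj.
by rewrite mono_compE dE gE unbumpKcond; have := afj i; lia.
Qed.

End MonotoneMaps.

Section SimplicialSets.

Definition yoneda (X : simplicial_set) n (x : X n) :
  simplicial_map (std_simplex n) X :=
  @SimplicialMap (std_simplex n) X (fun m f => act f x)
    (fun l m f g => act_comp g f x).

Definition prodS (X Y : simplicial_set) : simplicial_set.
Proof.
refine (@SimplicialSet (fun n => X n * Y n)%type
  (fun m n f x => (act f x.1, act f x.2)) _ _).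
- by move=> n [x y]; rewrite !act_id.
- by move=> l m n g f [x y]; rewrite !act_comp.
Defined.

Definition sub_set (X : simplicial_set) (S : forall n, X n -> Prop)
    (S_act : forall m n (f : mono_map m n) x, S n x -> S m (act f x)) :
  simplicial_set.
Proof.
refine (@SimplicialSet (fun n => {x : X n | S n x})
  (fun m n f x => exist _ (act f (sval x)) (S_act _ _ f _ (svalP x))) _ _).
- by move=> n [x Sx]; apply: eq_exist; rewrite /= act_id.
- by move=> l m n g f [x Sx]; apply: eq_exist; rewrite /= act_comp.
Defined.

Definition prod_map (T X Y : simplicial_set) (f : simplicial_map T X)
    (g : simplicial_map T Y) : simplicial_map T (prodS X Y).
Proof.
refine (@SimplicialMap T (prodS X Y) (fun n t => (f n t, g n t)) _).
by move=> m n a t /=; rewrite !smap_act.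
Defined.

Definition fst_map X Y : simplicial_map (prodS X Y) X :=
  @SimplicialMap (prodS X Y) X (fun n t => t.1) (fun _ _ _ _ => erefl).

Definition snd_map X Y : simplicial_map (prodS X Y) Y :=
  @SimplicialMap (prodS X Y) Y (fun n t => t.2) (fun _ _ _ _ => erefl).

End SimplicialSets.

(** * Lifting properties in terms of partial maps *)

Section PartialMaps.

(** A map over [F] from a subobject of [T] to [E], encoded by its graph. *)
Record partial_map (T E F : simplicial_set) (p : simplicial_map E F)
    (v : simplicial_map T F) := PartialMap {
  graph : forall n, T n -> E n -> Prop;
  graph_act : forall m n (f : mono_map m n) x e,
    graph x e -> graph (act f x) (act f e);
  graph_fun : forall n (x : T n) e e', graph x e -> graph x e' -> e = e';
  graph_over : forall n (x : T n) e, graph x e -> p n e = v n x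
}.

Variables (E F : simplicial_set) (p : simplicial_map E F).

Definition dom T (v : simplicial_map T F) (G : partial_map p v) n (x : T n) :=
  exists e, graph G x e.

Definition extends T (v : simplicial_map T F) (G : partial_map p v) :=
  exists h : simplicial_map T E,
    (forall n x, p n (h n x) = v n x) /\
    (forall n (x : T n) e, graph G x e -> h n x = e).

(** The predicate [S] is not asked to be closed under the simplicial operators: this follows once it
    is the domain of a partial map. *)
Definition lifts (T : simplicial_set) (S : forall n, T n -> Prop) :=
  forall (v : simplicial_map T F) (G : partial_map p v),
    (forall n (x : T n), dom G x <-> S n x) -> extends G.

Lemma dom_act T (v : simplicial_map T F) (G : partial_map p v) m n
  (f : mono_map m n) x : dom G x -> dom G (act f x).
Proof. by case=> e Ge; exists (act f e); apply: graph_act. Qed.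

Lemma partial_map_ext T (v : simplicial_map T F) (G G' : partial_map p v) :
  (forall n (x : T n) e, graph G x e <-> graph G' x e) -> G = G' :> partial_map p v.
Proof.
case: G G' => [G a b c] [G' a' b' c'] /= eGG'.
have {}eGG' : G = G'.
  apply: functional_extensionality_dep => n.
  by apply: funext => x; apply: funext => e; apply/propext.
by subst G'; congr PartialMap; apply: Prop_irrelevance.
Qed.

Lemma total_extends T (v : simplicial_map T F) (G : partial_map p v) :
  (forall n (x : T n), dom G x) -> extends G.
Proof.
move=> tG; pose h n x := projT1 (cid (tG n x)).
have hP n x : graph G x (h n x) by apply: (projT2 (cid (tG n x))).
have ha m n (f : mono_map m n) (x : T n) : h m (act f x) = act f (h n x).
  by apply: (graph_fun (hP _ _)); apply: graph_act.
exists (SimplicialMap ha); split=> [n x|n x e Ge] /=.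
  exact: (graph_over (hP _ _)).
exact: (graph_fun (hP _ _) Ge).
Qed.

(** As [G] is single-valued, [a] can be sent to the value of [G] at [i a], even if [i] is not
    injective. *)
Lemma rlp_lifts (A T : simplicial_set) (i : simplicial_map A T)
    (S : forall n, T n -> Prop) :
  @rlp sSet A T E F i p -> (forall n x, S n x <-> exists a, i n a = x) ->
  lifts S.
Proof.
move=> ip Si v G domG.
have dG n a : dom G (i n a) by apply/domG/Si; exists a.
pose u n a := projT1 (cid (dG n a)).
have uP n a : graph G (i n a) (u n a) by apply: (projT2 (cid (dG n a))).
have ua m n (f : mono_map m n) a : u m (act f a) = act f (u n a).
  by apply: (graph_fun (uP _ _)); rewrite smap_act; apply: graph_act.
have [|h [hi ph]] := ip (SimplicialMap ua) v.
  by apply: simplicial_map_ext => n a /=; apply: (graph_over (uP _ _)).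
exists h; split=> [n x|n x e Ge].
  by rewrite -ph.
have [a ia] : exists a, i n a = x by apply/Si/domG; exists e.
rewrite -ia in Ge *; rewrite -(graph_fun (uP _ _) Ge).
by rewrite -[RHS]/(SimplicialMap ua n a) -hi.
Qed.

Lemma sub_lifts (T : simplicial_set) (S S' : forall n, T n -> Prop) :
  (forall n x, S n x <-> S' n x) -> lifts S -> lifts S'.
Proof.
move=> SS' lS v G dG; apply: (lS v G) => n x; rewrite dG.
by apply: iff_sym; apply: SS'.
Qed.

(** Attaching a cell: only the part of [W] outside of the domain of [G] has
    to be embedded by [sigma]. *)
Lemma attach (W Q : simplicial_set) (v : simplicial_map Q F)
    (G : partial_map p v) (sigma : simplicial_map W Q) :
  (forall n w w', sigma n w = sigma n w' -> w = w' \/ dom G (sigma n w)) ->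
  lifts (fun n (w : W n) => dom G (sigma n w)) ->
  exists G' : partial_map p v,
    (forall n (x : Q n) e, graph G x e -> graph G' x e) /\
    (forall n (x : Q n), dom G' x <-> dom G x \/ exists w, sigma n w = x).
Proof.
move=> inj lft.
pose v' := simplicial_comp v sigma.
unshelve refine (let Gs : partial_map p v' := @PartialMap W E F p v'
  (fun n w e => graph G (sigma n w) e) _ _ _ in _).
- by move=> m n f w e; rewrite smap_act; apply: graph_act.
- by move=> n w e e'; apply: graph_fun.
- by move=> n w e; apply: graph_over.
have [//|h [ph hG]] := lft v' Gs.
rewrite /= in hG ph.
unshelve refine (let G' : partial_map p v := @PartialMap Q E F p v
  (fun n x e => graph G x e \/ exists2 w, sigma n w = x & h n w = e) _ _ _ in _).
- move=> m n f x e [Ge|[w <- <-]]; first by left; apply: graph_act.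
  by right; exists (act f w); rewrite smap_act.
(* Two points of [W] over the same simplex coincide, or that simplex lies in the domain of [G],
   where [h] is forced. *)
- move=> n x e e' [Ge|[w sw hw]] [Ge'|[w' sw' hw']].
  + exact: graph_fun Ge Ge'.
  + by rewrite -hw'; symmetry; apply: hG; rewrite sw'.
  + by rewrite -hw; apply: hG; rewrite sw.
  + have [eww'|[d dG]] := inj _ w w' (etrans sw (esym sw')).
      by rewrite -hw -hw' eww'.
    by rewrite -hw -hw' (hG _ _ _ dG) (hG n w' d) // sw' -sw.
- by move=> n x e [/graph_over//|[w <- <-]]; rewrite ph.
exists G'; split=> /= [n x e Ge|n x]; first by left.
split=> [[e /= [Ge|[w sw _]]]|[[e Ge]|[w sw]]].
- by left; exists e.
- by right; exists w.
- by exists e; left.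
- by exists (h n w); right; exists w.
Qed.

End PartialMaps.

(** * Prisms *)

Section Prisms.

Lemma in_hornE n (k : 'I_n.+1) m (x : mono_map m n) :
  in_horn k x <-> exists2 j, j <= n & j <> k /\ avoids x j.
Proof.
split=> [/existsP[j /andP[njk /forallP xj]]|[j lj [njk xj]]].
  exists j; first by rewrite -ltnS.
  by split=> [/ord_inj|i /ord_inj]; apply/eqP.
apply/existsP; exists (inord j); apply/andP; split.
  by apply/eqP => ejk; apply: njk; rewrite -ejk inordK.
by apply/forallP => i; apply/eqP => xij; apply: (xj i); rewrite xij inordK.
Qed.

Definition efib (e : bool) (X Y : sSet) (p : hom X Y) : Prop :=
  forall (n : nat) (k : 'I_n.+1), 1 <= n -> (if e then 0 < k else k < n) ->
  rlp (horn_incl k) p.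

Definition constant_at m (e : bool) (s : mono_map m 1) : Prop :=
  forall i, s i = e :> nat.

Variables (e : bool) (n : nat).

Let prism := prodS (std_simplex n) (std_simplex 1).

(** The subcomplex ∂Δ^n × Δ^1 ∪ Δ^n × {e} of the prism. *)
Definition prism_base m (z : prism m) : Prop :=
  (exists2 j, j <= n & avoids z.1 j) \/ constant_at e z.2.

(** The image of the shuffle [(0,0) < ... < (i,0) < (i,1) < ... < (n,1)]. *)
Definition in_shuffle (i : nat) m (z : prism m) : Prop :=
  forall a : 'I_m.+1, (z.2 a = 0 :> nat -> z.1 a <= i) /\
                      (z.2 a = 1 :> nat -> i <= z.1 a).

(** Shuffles enter by increasing [i] if [e] is true and by decreasing [i] otherwise, starting from
    the one that has Δ^n × {e} as a face. *)
Definition prism_stage t m (z : prism m) : Prop :=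
  prism_base z \/
  exists2 i, in_shuffle i z & i <= n /\ (if e then i < t else n < i + t).

Lemma in_some_shuffle m (z : prism m) : exists2 i, i <= n & in_shuffle i z.
Proof.
(* The largest first coordinate at height [0]; an empty maximum is [0]. *)
exists (\max_(a < m.+1 | z.2 a == 0 :> nat) z.1 a).
  by apply/bigmax_leqP => a _; rewrite -ltnS.
move=> a; split=> za; first by apply: leq_bigmax_cond; rewrite za.
apply/bigmax_leqP => b /eqP zb; apply: mono_mapP.
by rewrite leqNgt; apply/negP => /ltnW/(mono_mapP z.2); rewrite za zb.
Qed.

(** The first component is the degeneracy repeating [i]; the second jumps to [1] right after
    position [i]. *)
Lemma shuffle_cell i : i <= n -> exists sigma : prism n.+1,
  (forall x, sigma.1 x = x - (i < x) :> nat) /\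
  (forall x, sigma.2 x = (i < x) :> nat).
Proof.
move=> lin.
have [d dE] : exists d : mono_map n.+1 n, forall x, d x = x - (i < x) :> nat.
  by apply: nat_mono => [x|x y]; [have := ltn_ord x|]; lia.
have [c cE] : exists c : mono_map n.+1 1, forall x, c x = (i < x) :> nat.
  by apply: nat_mono => [x|x y]; lia.
by exists (d, c).
Qed.

(** The face of the shuffle opposite [j] lies in ∂Δ^n × Δ^1 unless [j] is [i] or [i.+1]. These two
    faces are shared with the shuffles [i - 1] and [i + 1], except that they are Δ^n × {1} when
    [i = 0] and Δ^n × {0} when [i = n], respectively. Exactly one of them is present at stage [t],
    so the part already present is a horn. *)
Lemma shuffle_cell_stage t i (sigma : prism n.+1) m (y : mono_map m n.+1) :
  t <= n -> i = (if e then t else n - t) ->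
  (forall x, sigma.1 x = x - (i < x) :> nat) ->
  (forall x, sigma.2 x = (i < x) :> nat) ->
  prism_stage t (act y sigma) <->
  exists2 j, j <= n.+1 & j <> (if e then i.+1 else i) /\ avoids y j.
Proof.
move=> ltn iE s1 s2.
have x1 a : (act y sigma).1 a = y a - (i < y a) :> nat.
  by rewrite /= mono_compE s1.
have x2 a : (act y sigma).2 a = (i < y a) :> nat.
  by rewrite /= mono_compE s2.
split=> [[[[j lj aj]|ce]|[i' sh [li' oi']]]|[j lj [njk aj]]].
- have [lji|lij|eij] := ltngtP j i.
  + exists j; [lia|split=> [|a]; first by case: (e); lia].
    by have := aj a; rewrite x1; lia.
  + exists j.+1; [lia|split=> [|a]; first by case: (e); lia].
    by have := aj a; rewrite x1; lia.
  + exists (if e then i else i.+1); first by case: (e); lia.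
    split=> [|a]; first by case: (e); lia.
    by have := aj a; rewrite x1; case: (e); lia.
- exists (if e then 0 else n.+1); first by case: (e).
  split=> [|a]; first by case: (e) iE; lia.
  by have := ce a; rewrite x2; case: (e) iE; have := ltn_ord (y a); lia.
- exists (if e then i else i.+1); first by case: (e) iE; lia.
  split=> [|a]; first by case: (e); lia.
  by have := sh a; rewrite x1 x2; case: (e) iE oi'; lia.
- have [lji|lij|eij] := ltngtP j i.
  + left; left; exists j; first by case: (e) iE; lia.
    by move=> a; have := aj a; rewrite x1; lia.
  + have [lji1|lij1|eij1] := ltngtP j i.+1; first by lia.
      left; left; exists j.-1; first by lia.
      by move=> a; have := aj a; rewrite x1; lia.
    case ee: (e) iE njk => iE njk; first by lia.
    have [lin|] := ltnP i n; last first.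
      move=> lni; left; right=> a.
      by have := aj a; have := ltn_ord (y a); rewrite x2; lia.
    right; exists i.+1; last by rewrite ee; lia.
    by move=> a; have := aj a; rewrite x1 x2; lia.
  + case ee: (e) iE njk => iE njk; last by lia.
    case: i => [|i] in eij iE njk s1 s2 x1 x2 *.
      by left; right=> a; have := aj a; rewrite x2; lia.
    right; exists i; last by rewrite ee; lia.
    by move=> a; have := aj a; rewrite x1 x2; lia.
Qed.

Lemma shuffle_cell_image i (sigma : prism n.+1) m (z : prism m) :
  i <= n ->
  (forall x, sigma.1 x = x - (i < x) :> nat) ->
  (forall x, sigma.2 x = (i < x) :> nat) ->
  in_shuffle i z <-> exists y : mono_map m n.+1, act y sigma = z.
Proof.
move=> lin s1 s2; split=> [sh|[y <-] a]; last first.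
  by rewrite /= !mono_compE s1 s2; lia.
(* The vertex [(x, s)] of the shuffle is at position [x + s] of its chain. *)
have [y yE] : exists y : mono_map m n.+1, forall a, y a = z.1 a + z.2 a :> nat.
  apply: nat_mono => [a|a b lab].
    by have := ltn_ord (z.1 a); have := ltn_ord (z.2 a); lia.
  by have := mono_mapP z.1 lab; have := mono_mapP z.2 lab; lia.
exists y; case: z => z1 z2 /= in sh yE *; congr pair; apply: mono_ext => a.
  apply: ord_inj; rewrite mono_compE s1 yE.
  by have := sh a; have := ltn_ord (z2 a); rewrite /=; lia.
apply: ord_inj; rewrite mono_compE s2 yE.
by have := sh a; have := ltn_ord (z2 a); rewrite /=; lia.
Qed.

(** Each shuffle in turn is filled as an [n.+1]-simplex from a horn allowed in [efib e]: at
    [i.+1 > 0] if [e] is true, at [i < n.+1] otherwise. *)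
Lemma prism_lifts (E F : sSet) (p : hom E F) :
  efib e p -> lifts p prism_base.
Proof.
move=> fp v G dG.
have stage t : t <= n.+1 -> exists G' : partial_map p v,
    (forall m (z : prism m) x, graph G z x -> graph G' z x) /\
    (forall m (z : prism m), dom G' z <-> prism_stage t z).
  elim: t => [_|t IH ltn].
    exists G; split=> // m z; rewrite dG; split=> [bz|[//|[i _ [lin]]]].
      by left.
    by case: (e); lia.
  have [|G' [GG' dG']] := IH _; first exact: ltnW.
  pose i := if e then t else n - t.
  have lin : i <= n by rewrite /i; case: (e); lia.
  have [sigma [s1 s2]] := shuffle_cell lin.
  have kn : (if e then i.+1 else i) < n.+2 by case: (e); lia.
  have [||G'' [GG'' dG'']] := @attach _ _ p (std_simplex n.+1) prism v G'
      (yoneda (X := prism) sigma).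
  - move=> m w w' ew; left; apply: mono_ext => a; apply: ord_inj.
    have := congr1 (fun z : prism m => z.2 a : nat) ew.
    have := congr1 (fun z : prism m => z.1 a : nat) ew.
    by rewrite !mono_compE !s1 !s2; lia.
  - apply: (@rlp_lifts _ _ p _ _ (horn_incl (Ordinal kn))).
      by apply: fp => //=; case: (e); lia.
    move=> m y; rewrite dG' (@shuffle_cell_stage t i) //.
    rewrite -(@in_hornE n.+1 (Ordinal kn)).
    split=> [hy|[[y' hy'] <- //]].
    by exists (exist _ y hy).
  exists G''; split=> [m z x /GG'/GG'' //|m z].
  rewrite dG'' dG' /= -(shuffle_cell_image _ lin s1 s2) /prism_stage; split.
    case=> [[bz|[i' sh [li' oi']]]|sh]; first by left.
      by right; exists i' => //; split=> //; case: (e) oi'; lia.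
    by right; exists i => //; split=> //; rewrite /i; case: (e); lia.
  case=> [bz|[i' sh [li' oi']]]; first by left; left.
  have [<-|ni] := eqVneq i' i; first by right.
  left; right; exists i' => //; split=> //.
  by move: oi' ni; rewrite /i; case: (e); lia.
have [G' [GG' dG']] := stage n.+1 (leqnn _).
have [|h [ph hG']] := @total_extends _ _ p _ v G'.
  move=> m z; apply/dG'; right; have [i lin sh] := in_some_shuffle z.
  by exists i => //; split=> //; case: (e); lia.
by exists h; split=> // m z x /GG'/hG'.
Qed.

End Prisms.

(** * Cylinders *)

Section Cylinders.

Definition vertex1 (e : bool) : 'I_2 := inord e.

Definition const1 (e : bool) m : mono_map m 1 := mono_const m (vertex1 e).

Lemma const1E e m i : const1 e m i = e :> nat.
Proof. by rewrite mk_monoE inordK //; case: e. Qed.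

Lemma act_const1 e m n (f : mono_map m n) :
  mono_comp (const1 e n) f = const1 e m.
Proof. by apply: mono_ext => i; apply: ord_inj; rewrite mono_compE !const1E. Qed.

Lemma constant_at_act e m n (f : mono_map m n) (s : mono_map n 1) :
  constant_at e s -> constant_at e (mono_comp s f).
Proof. by move=> cs i; rewrite mono_compE. Qed.

Lemma not_constant_at e n : ~ constant_at e (const1 (~~ e) n).
Proof. by move=> /(_ ord0); rewrite const1E; case: e. Qed.

Definition cylinder (T : simplicial_set) := prodS T (std_simplex 1).

Variables (e : bool) (E F T : simplicial_set) (p : simplicial_map E F)
  (v : simplicial_map (cylinder T) F).

(** The domain has the form S × Δ^1 ∪ T × {e}, said without naming the subobject S of [T]. *)
Definition cylindrical (G : partial_map p v) : Prop :=
  (forall n (x : T n) (s : mono_map n 1), constant_at e s ->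
     dom G (T := cylinder T) (x, s)) /\
  (forall n (x : T n) (s s' : mono_map n 1), ~ constant_at e s ->
     dom G (T := cylinder T) (x, s) -> dom G (T := cylinder T) (x, s')).

Lemma maximal_cylindrical (G0 : partial_map p v) : cylindrical G0 ->
  exists G : partial_map p v, [/\ cylindrical G,
    forall n (z : cylinder T n) x, graph G0 z x -> graph G z x &
    forall G' : partial_map p v, cylindrical G' ->
      (forall n (z : cylinder T n) x, graph G z x -> graph G' z x) ->
      G' = G].
Proof.
move=> cG0.
pose P (G : partial_map p v) := cylindrical G /\
  forall n (z : cylinder T n) x, graph G0 z x -> graph G z x.
pose le (G G' : {G | P G}) := `[< forall n (z : cylinder T n) x,
  graph (sval G) z x -> graph (sval G') z x >].
have [||||[G [cG leG]] Gmax] := @Zorn {G | P G} le.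
- by move=> G; apply/asboolP.
- move=> G1 G2 G3 /asboolP l12 /asboolP l23.
  by apply/asboolP => n z x /l12/l23.
- move=> [G PG] [G' PG'] /asboolP l /asboolP l'; apply: eq_exist => /=.
  by apply: partial_map_ext => n z x; split; [apply: l|apply: l'].
- move=> A tA.
  (* A chain is bounded by the union of its graphs; [G0] is added for the sake of the empty
     chain. *)
  unshelve refine (let G : partial_map p v := @PartialMap _ E F p v
    (fun n z x => graph G0 z x \/ exists2 G, A G & graph (sval G) z x) _ _ _ in _).
  + move=> m n f z x [Gx|[G AG Gx]]; first by left; apply: graph_act.
    by right; exists G => //; apply: graph_act.
  + move=> n z x x' [Gx|[G AG Gx]] [Gx'|[G' AG' Gx']].
    * exact: graph_fun Gx Gx'.
    * exact: graph_fun ((svalP G').2 _ _ _ Gx) Gx'.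
    * exact: graph_fun Gx ((svalP G).2 _ _ _ Gx').
    * have [/asboolP l|/asboolP l] := tA _ _ AG AG'.
        exact: graph_fun (l _ _ _ Gx) Gx'.
      exact: graph_fun Gx (l _ _ _ Gx').
  + by move=> n z x [/graph_over|[G AG /graph_over]].
  have PG : P G.
    split=> [|n z x Gx]; last by left.
    split=> [n x s|n x s s' ns [y [Gy|[G' AG' Gy]]]].
    * by case/(cG0.1 _ x) => y Gy; exists y; left.
    * by have [|y' Gy'] := cG0.2 _ x s s' ns; [exists y|exists y'; left].
    * have [|y' Gy'] := (svalP G').1.2 _ x s s' ns; first by exists y.
      by exists y'; right; exists G'.
  exists (exist _ G PG) => G' AG'; apply/asboolP => n z x Gx.
  by right; exists G'.
exists G; split=> // G' cG' l.
have PG' : P G' by split=> // n z x /leG/l.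
have := Gmax (exist _ G' PG'); rewrite /le /=.
by move=> /(_ (asboolT l)) [].
Qed.

(** A maximal extension is total: over a simplex [x] of least dimension that is not full, [x] is
    non-degenerate with full boundary, and the prism on [x] could still be attached. *)
Lemma cylindrical_extends (G0 : partial_map p v) :
  efib e p -> cylindrical G0 -> extends G0.
Proof.
move=> fp /maximal_cylindrical[G [cG leG Gmax]].
pose full n (x : T n) := forall s : mono_map n 1, dom G (T := cylinder T) (x, s).
have full_act m n (f : mono_map m n) x : full n x -> full m (act f x).
  move=> fx s; apply: (cG.2 _ _ (const1 (~~ e) m)); first exact: not_constant_at.
  by have := dom_act f (fx (const1 (~~ e) n)); rewrite /= act_const1.
suff all_full n (x : T n) : full n x.
  have [|h [ph hG]] := @total_extends _ _ p _ v G.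
    by move=> n [x s]; apply: all_full.
  by exists h; split=> // n x y /leG/hG.
have [k] := ubnP n; elim: k n x => // k IH n x ltnk.
have {}IH m (y : T m) : m < n -> full m y by move=> lmn; apply: IH; lia.
have [//|nfx] := pselect (full n x).
have nsurj_full m (f : mono_map m n) : ~ surj f -> full m (act f x).
  move=> /not_surj[j lj] /(avoids_factor lj)[n' [d [g [ltn' ->]]]].
  by rewrite act_comp; apply: full_act; apply: IH.
(* A section of [f] exhibits [x] as a face of this degeneracy, so fullness would pass to [x]. *)
have surj_nfull m (f : mono_map m n) : surj f -> ~ full m (act f x).
  move=> sf ff; apply: nfx.
  have [t [ft _]] := surj_mono_section ord0 sf.
  suff -> : x = act t (act f x) by apply: full_act.
  rewrite -act_comp -[LHS]act_id; congr act.
  by apply: mono_ext => i; rewrite mono_compE mono_idE ft.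
(* The Eilenberg-Zilber argument: for a section [t] of [f] through [a], the simplex [x] is its own
   pullback along [g t]. If [g t] were not surjective, [x] would be full; hence [g t] is the
   identity and [g a = f a]. *)
have surj_inj m (f g : mono_map m n) :
    surj f -> surj g -> act f x = act g x -> f = g.
  move=> sf sg efg; apply: mono_ext => a.
  have [t [ft tf]] := surj_mono_section a sf.
  have xgt : x = act (mono_comp g t) x.
    rewrite act_comp -efg -act_comp -[LHS]act_id; congr act.
    by apply: mono_ext => i; rewrite mono_compE mono_idE ft.
  have gt : mono_comp g t = mono_id n.
    have [/surj_mono_endo//|ns] := pselect (surj (mono_comp g t)).
    by case: nfx; rewrite xgt; apply: nsurj_full.
  have := congr1 (fun c : mono_map n n => c (f a)) gt.
  by rewrite mono_compE mono_idE tf.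
pose sigma : simplicial_map (prodS (std_simplex n) (std_simplex 1)) (cylinder T) :=
  prod_map (simplicial_comp (yoneda x) (fst_map _ _)) (snd_map _ _).
have dom_sigma m (z : prodS (std_simplex n) (std_simplex 1) m) :
    dom G (sigma m z) <-> prism_base e z.
  case: z => f s; split=> [dz|[[j lj aj]|cs]].
  - have [cs|ns] := pselect (constant_at e s); first by right.
    left; apply/not_surj => sf; apply: (surj_nfull _ f sf) => s'.
    exact: cG.2 ns dz.
  - by apply: nsurj_full; apply/not_surj; exists j.
  - exact: cG.1.
have [||G' [leG' domG']] := @attach _ _ p _ _ v G sigma.
- move=> m [f s] [f' s'] /= [eff' ess']; rewrite ess'.
  have [sf|/nsurj_full ff] := pselect (surj f); last by right.
  have [sf'|/nsurj_full ff] := pselect (surj f').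
    by left; rewrite (surj_inj _ _ _ sf sf' eff').
  by right; rewrite /dom /= eff'; apply: ff.
- apply: (@sub_lifts _ _ p _ (prism_base e (n := n))); last exact: prism_lifts.
  by move=> m z; apply: iff_sym.
have cG' : cylindrical G'.
  split=> [m y s cs|m y s s' ns].
    by apply/domG'; left; apply: cG.1.
  move/domG' => [dy|[[f s0] /= [<- _]]]; apply/domG'.
    by left; apply: cG.2 dy.
  by right; exists (f, s').
(* By maximality nothing was added, although the prism on [x] is now in the domain. *)
have eG := Gmax _ cG' leG'.
move=> s; rewrite -eG; apply/domG'; right.
by exists (mono_id n, s); rewrite /= act_id.
Qed.

End Cylinders.

Lemma cylinder_lifts e (E F : sSet) (p : hom E F) (T : simplicial_set)
    (S : forall n, T n -> Prop) : efib e p ->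
  lifts p (fun n (z : cylinder T n) => S n z.1 \/ constant_at e z.2).
Proof.
move=> fp v G dG; apply: (@cylindrical_extends e) => //.
split=> [n x s cs|n x s s' ns /dG/= [Sx|//]]; apply/dG; first by right.
by left.
Qed.

(** The inclusion of [S] is a retract of that of S × Δ^1 ∪ T × {e} in the cylinder: [T] enters at
    the end [~~ e], and [H] leads back. *)
Lemma retract_lifts e (E F : sSet) (p : hom E F) (T : simplicial_set)
    (S : forall n, T n -> Prop) (H : simplicial_map (cylinder T) T) :
  efib e p ->
  (forall n (x : T n), H n (x, const1 (~~ e) n) = x) ->
  (forall n (x : T n) s, constant_at e s -> S n (H n (x, s))) ->
  (forall n (x : T n) s, S n x -> S n (H n (x, s))) ->
  lifts p S.
Proof.
move=> fp H0 H1 HS v G dG.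
have S_act m n (f : mono_map m n) x : S n x -> S m (act f x).
  by move=> /dG/(dom_act f)/dG.
unshelve refine (let G' : partial_map p (simplicial_comp v H) :=
  @PartialMap (cylinder T) E F p (simplicial_comp v H)
  (fun n z y => (S n z.1 \/ constant_at e z.2) /\ graph G (H n z) y) _ _ _ in _).
- move=> m n f [x s] y [Sx Gy]; split; last first.
    by rewrite smap_act; apply: graph_act.
  by case: Sx => [Sx|cs]; [left; apply: S_act|right; apply: constant_at_act].
- by move=> n z y y' [_ Gy] [_]; apply: graph_fun Gy.
- by move=> n z y [_ /graph_over].
have [|h [ph hG']] := @cylinder_lifts e E F p T S fp _ G'.
  move=> n [x s]; split=> [[y [] //]|Sx].
  have /dG[y Gy] : S n (H n (x, s)).
    by case: Sx => [Sx|cs]; [apply: HS|apply: H1].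
  by exists y.
have a m n (f : mono_map m n) x :
    h m (act f x, const1 (~~ e) m) = act f (h n (x, const1 (~~ e) n)).
  by rewrite -smap_act /= act_const1.
exists (@SimplicialMap T E (fun n x => h n (x, const1 (~~ e) n)) a).
split=> [n x|n x y Gy] /=; first by rewrite ph /= H0.
apply: hG' => /=; rewrite H0; split=> //; left.
by apply/dG; exists y.
Qed.

(** * Dependent products *)

Section Pullbacks.

Variables (X Y Z : simplicial_set) (f : simplicial_map X Z)
  (g : simplicial_map Y Z).

Lemma pullback_subproof m n (a : mono_map m n) (t : prodS X Y n) :
  f n t.1 = g n t.2 -> f m (act a t).1 = g m (act a t).2.
Proof. by rewrite /= !smap_act => ->. Qed.

Definition pullback : simplicial_set := sub_set pullback_subproof.

Definition pullback_fst : simplicial_map pullback X :=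
  @SimplicialMap pullback X (fun n t => (sval t).1) (fun _ _ _ _ => erefl).

Definition pullback_snd : simplicial_map pullback Y :=
  @SimplicialMap pullback Y (fun n t => (sval t).2) (fun _ _ _ _ => erefl).

End Pullbacks.

(** Since [e]-fibrations are stable under pullback to [Z], this is the left lifting property of [i]
    against all of them, phrased with sections only. *)
Definition has_section_extensions (e : bool) (A Z : simplicial_set)
    (i : simplicial_map A Z) : Prop :=
  forall (D : simplicial_set) (d : simplicial_map D Z) (a : simplicial_map A D),
  @efib e D Z d -> (forall n x, d n (a n x) = i n x) ->
  exists s : simplicial_map Z D,
    (forall n z, d n (s n z) = z) /\ (forall n x, s n (i n x) = a n x).

Section DependentProduct.

Variables (A Z Q E F : simplicial_set) (i : simplicial_map A Z)
  (b : simplicial_map Q Z) (p : simplicial_map E F) (v : simplicial_map Q F)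
  (P : forall n, Q n -> Prop) (G : partial_map p v).

Hypothesis P_act : forall m n (f : mono_map m n) x, P x -> P (act f x).
Hypothesis domG : forall n (x : Q n), dom G x <-> P x \/ exists a, i n a = b n x.

(** An [n]-simplex of the dependent product along [b] of [E] over [F]: a
    simplex [z] of [Z] with the graph of a map from the pullback of [Q] along
    [z] to [E], which is required to agree with [G] on [P].  Its elements are
    indexed by [f : [m] -> [n]] and [q : Q m] with [b q = f^* z]. *)
Record family n := Family {
  base : Z n;
  value : forall m, mono_map m n -> Q m -> E m -> Prop;
  value_base : forall m (f : mono_map m n) q y,
    value f q y -> b m q = act f base;
  value_total : forall m (f : mono_map m n) q,
    b m q = act f base -> exists y, value f q y;
  value_fun : forall m (f : mono_map m n) q y y',
    value f q y -> value f q y' -> y = y';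
  value_over : forall m (f : mono_map m n) q y, value f q y -> p m y = v m q;
  value_act : forall l m (g : mono_map l m) (f : mono_map m n) q y,
    value f q y -> value (mono_comp f g) (act g q) (act g y);
  value_fix : forall m (f : mono_map m n) q y, value f q y -> P q -> graph G q y
}.

(** One inclusion of graphs suffices: both are single-valued and total over the same elements. *)
Lemma family_ext n (D D' : family n) : base D = base D' ->
  (forall m (f : mono_map m n) q y, value D f q y -> value D' f q y) -> D = D'.
Proof.
move=> ez l.
have {l}eR : value D = value D'.
  apply: functional_extensionality_dep => m.
  apply: funext => f; apply: funext => q; apply: funext => y; apply/propext.
  split=> [/l//|Dy]; have [|y' D'y] := @value_total _ D m f q.
    by rewrite ez; apply: value_base Dy.
  by rewrite (value_fun Dy (l _ _ _ _ D'y)).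
case: D D' ez eR => [z R a1 a2 a3 a4 a5 a6] [z' R' a1' a2' a3' a4' a5' a6'] /=.
by move=> ez eR; subst z' R'; congr Family; apply: Prop_irrelevance.
Qed.

Definition family_act m n (g : mono_map m n) (D : family n) : family m.
Proof.
refine (@Family m (act g (base D)) (fun l f => value D (mono_comp g f)) _ _ _ _ _ _).
- by move=> l f q y /value_base; rewrite act_comp.
- by move=> l f q; rewrite -act_comp; apply: value_total.
- by move=> l f q y y'; apply: value_fun.
- by move=> l f q y; apply: value_over.
- move=> k l h f q y /(value_act h); congr value.
  by apply: mono_ext => x; rewrite !mono_compE.
- by move=> l f q y; apply: value_fix.
Defined.

Definition families : simplicial_set.
Proof.
refine (@SimplicialSet family family_act _ _).
- move=> n D; apply: family_ext => [|m f q y] /=; first exact: act_id.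
  suff -> : mono_comp (mono_id n) f = f by [].
  by apply: mono_ext => x; rewrite mono_compE mono_idE.
- move=> l m n g f D; apply: family_ext => [|k h q y] /=; first exact: act_comp.
  suff -> : mono_comp (mono_comp g f) h = mono_comp g (mono_comp f h) by [].
  by apply: mono_ext => x; rewrite !mono_compE.
Defined.

Definition families_base : simplicial_map families Z :=
  @SimplicialMap families Z base (fun _ _ _ _ => erefl).

(** By adjunction, this is what horn filling in [families] over [z] amounts to. *)
Definition horn_fibers_lift e : Prop :=
  forall n (k : 'I_n.+1) (z : Z n), 1 <= n -> (if e then 0 < k else k < n) ->
  lifts p (fun m (t : pullback b (yoneda z) m) =>
             P (sval t).1 \/ in_horn k (sval t).2).

(** A horn of families over [z] glues with [G] on [P] to a partial map [GT] on the pullback of [b]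
    along [z], consistently by [value_fix]. An extension of [GT] is a family filling the horn. *)
Lemma families_efib e : horn_fibers_lift e -> @efib e families Z families_base.
Proof.
move=> lft n k n_gt0 kP u z' ez'.
pose z := z' n (mono_id n).
have zE m (f : mono_map m n) : z' m f = act f z.
  rewrite /z -smap_act; congr (z' m); apply: mono_ext => x.
  by rewrite mono_compE mono_idE.
have uz m (f : horn k m) : base (u m f) = act (sval f) z.
  by have := congr1 (fun h : simplicial_map _ _ => h m f) ez'; rewrite /= zE.
pose T := pullback b (yoneda z).
pose vT := simplicial_comp v (pullback_fst b (yoneda z)).
unshelve refine (let GT : partial_map p vT := @PartialMap T E F p vT
  (fun m t y => (P (sval t).1 /\ graph G (sval t).1 y) \/
     exists2 f : horn k m, sval f = (sval t).2 &
       value (u m f) (mono_id m) (sval t).1 y) _ _ _ in _).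
- move=> l m g [[q f] tP] y /= [[Pq Gq]|[f' ef' uq]].
    by left; split; [apply: P_act|apply: graph_act].
  right; exists (act (s := horn k) g f'); first by rewrite -ef'.
  rewrite smap_act /=; move: (value_act g uq); congr value.
  by apply: mono_ext => x; rewrite !mono_compE !mono_idE.
- move=> m [[q f] tP] y y' /= [[Pq Gq]|[f1 ef1 uq]] [[Pq' Gq']|[f2 ef2 uq']].
  + exact: graph_fun Gq Gq'.
  + exact: graph_fun Gq (value_fix uq' Pq).
  + exact: graph_fun (value_fix uq Pq') Gq'.
  + have ef : f1 = f2 by apply: val_inj; apply: etrans ef1 (esym ef2).
    by rewrite ef in uq; apply: value_fun uq uq'.
- by move=> m [[q f] tP] y /= [[_ /graph_over]|[f' _ /value_over]].
have [|h [ph hG]] := lft n k z n_gt0 kP vT GT.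
  move=> m [[q f] tP] /=; split=> [[y /= [[Pq _]|[f' <- _]]]|[Pq|hf]].
  - by left.
  - by right; apply: (svalP f').
  - have /domG[y Gq] : P q \/ exists a, i m a = b m q by left.
    by exists y; left.
  have [|y uy] := @value_total _ (u m (exist _ f hf)) m (mono_id m) q.
    by rewrite uz act_id.
  by exists y; right; exists (exist _ f hf).
unshelve refine (let D : family n := @Family n z (fun m f q y =>
  exists tP : b m q = act f z, h m (exist _ (q, f) tP) = y) _ _ _ _ _ _ in _).
- by move=> m f q y [].
- by move=> m f q tP; exists (h m (exist _ (q, f) tP)); exists tP.
- by move=> m f q y y' [tP <-] [tP' <-]; congr (h m); apply: eq_exist.
- by move=> m f q y [tP <-]; rewrite ph.
- move=> l m g f q y [tP <-].
  have tP' : b l (act g q) = act (mono_comp f g) z by rewrite smap_act tP act_comp.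
  by exists tP'; rewrite -smap_act; congr (h l); apply: eq_exist.
- move=> m f q y [tP <-] Pq.
  have /domG[x Gq] : P q \/ exists a, i m a = b m q by left.
  by rewrite (hG _ _ x) //; left.
exists (@yoneda families n D); split; apply: simplicial_map_ext => m f /=.
  apply: esym; apply: family_ext => [|l g q y ug] /=; first exact: uz.
  have tP : b l q = act (mono_comp (sval f) g) z.
    by rewrite (value_base ug) uz act_comp.
  exists tP; refine (hG _ _ _ _); right; exists (act (s := horn k) g f) => //=.
  rewrite smap_act /=; move: ug; congr value.
  by apply: mono_ext => x; rewrite !mono_compE mono_idE.
by rewrite zE.
Qed.

(** Over the image of [i] the map [G] is defined everywhere, and it transposes to a map from [A] to
    [families]. A section extending this map, evaluated at identities, extends [G]; on [P] the
    agreement is built into [families]. *)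
Lemma dependent_lift e :
  has_section_extensions e i -> horn_fibers_lift e -> extends G.
Proof.
move=> ext /families_efib fib.
have dGi n (x : A n) m (f : mono_map m n) q :
    b m q = act f (i n x) -> dom G q.
  by move=> bq; apply/domG; right; exists (act f x); rewrite smap_act.
unshelve refine (let a n (x : A n) : family n := @Family n (i n x)
  (fun m f q y => b m q = act f (i n x) /\ graph G q y) _ _ _ _ _ _ in _).
- by move=> m f q y [].
- by move=> m f q bq; have [y Gy] := dGi _ _ _ _ _ bq; exists y.
- by move=> m f q y y' [_ Gy] [_]; apply: graph_fun Gy.
- by move=> m f q y [_ /graph_over].
- move=> l m g f q y [bq Gy]; split; last exact: graph_act.
  by rewrite smap_act bq act_comp.
- by move=> m f q y [].
have a_act m n (g : mono_map m n) x : a m (act g x) = family_act g (a n x).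
  apply: family_ext => [|l f q y] /=; first exact: smap_act.
  by rewrite smap_act act_comp.
have [//|s [bs sa]] :=
  ext families families_base (@SimplicialMap A families a a_act) fib.
have ss n (q : Q n) : exists y, value (s n (b n q)) (mono_id n) q y.
  by apply: value_total; rewrite act_id; apply: esym; apply: bs.
pose h n q := projT1 (cid (ss n q)).
have hP n q : value (s n (b n q)) (mono_id n) q (h n q).
  exact: (projT2 (cid (ss n q))).
have h_act m n (f : mono_map m n) q : h m (act f q) = act f (h n q).
  apply: (value_fun (hP _ _)); rewrite smap_act smap_act /=.
  move: (value_act f (hP n q)); congr value.
  by apply: mono_ext => x; rewrite !mono_compE !mono_idE.
exists (SimplicialMap h_act); split=> n q /=; first exact: value_over (hP n q).
move=> y Gy; have [Pq|[x ix]] : P q \/ exists a, i n a = b n q.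
- by apply/domG; exists y.
- exact: graph_fun (value_fix (hP n q) Pq) Gy.
- have := hP n q; rewrite -ix sa /= => -[_ Gq]; exact: graph_fun Gq Gy.
Qed.

End DependentProduct.

(** * Base change of horns and homotopies *)

Section FreeIsomorphism.

(** The nerve of the contractible groupoid on two objects. *)
Definition freeIso : simplicial_set.
Proof.
by refine (@SimplicialSet (fun n => 'I_n.+1 -> bool) (fun m n f x i => x (f i)) _ _)
  => [n x|l m n g f x]; apply: funext => i; rewrite ?mono_idE ?mono_compE.
Defined.

Definition object (c : bool) n : freeIso n := fun=> c.

#[global] Arguments object c n : clear implicits.

Lemma object_neq n : object true n <> object false n.
Proof. by move=> ej; have := congr1 (fun x : 'I_n.+1 -> bool => x ord0) ej. Qed.

Definition isoCylinder (X : simplicial_set) := prodS X freeIso.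

Definition cylinder_end (c : bool) (X : simplicial_set) :
  simplicial_map X (isoCylinder X) :=
  @SimplicialMap X (isoCylinder X) (fun n x => (x, object c n))
    (fun _ _ _ _ => erefl).

(** Simplices of [freeIso] are arbitrary sequences of objects, so this coordinate can be reset to
    [false] wherever the interval is at [e]. This deforms the cylinder onto its start for either
    value of [e]. *)
Lemma object_start_lifts e (X E F : sSet) (p : hom E F)
    (S : forall n, simplex X n -> Prop) : efib e p ->
  lifts p (fun n (x : isoCylinder X n) => S n x.1 \/ x.2 = object false n).
Proof.
move=> fp.
unshelve refine (let H : simplicial_map (cylinder (isoCylinder X)) (isoCylinder X) :=
  @SimplicialMap (cylinder (isoCylinder X)) (isoCylinder X)
  (fun n z => (z.1.1, fun a => if z.2 a == e :> nat then false else z.1.2 a)) _ in _).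
  by move=> m n f x /=; congr pair; apply: funext => a; rewrite mono_compE.
apply: (@retract_lifts e _ _ p _ _ H) => //.
- move=> n [x j] /=; congr pair; apply: funext => a.
  by rewrite const1E; case: (e).
- by move=> n x s cs /=; right; apply: funext => a; rewrite cs eqxx.
- move=> n [x j] s /= [Sx|->]; first by left.
  by right; apply: funext => a; case: ifP.
Qed.

End FreeIsomorphism.

Section BaseChange.

(** At the end [e] the image misses vertex [0] if [e] is true and [0 < k], and vertex [n] if [e] is
    false and [k < n], so it lies in the horn at [k]. Vertices stay or move to [k], so the horn is
    preserved throughout. *)
Lemma simplex_homotopy (e : bool) n (k : 'I_n.+1) :
  exists K : simplicial_map (cylinder (std_simplex n)) (std_simplex n),
  forall m (f : mono_map m n) (s : mono_map m 1) a,
    K m (f, s) a = (if s a == e :> nat then if e then maxn (f a) k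
                    else minn (f a) k else f a) :> nat.
Proof.
have ex m (z : cylinder (std_simplex n) m) : exists g : mono_map m n,
    forall a, g a = (if z.2 a == e :> nat then if e then maxn (z.1 a) k
                     else minn (z.1 a) k else z.1 a) :> nat.
  case: z => f s /=; apply: nat_mono => [a|a b lab].
    by have := ltn_ord (f a); have := ltn_ord k; case: ifP; case: (e); lia.
  have := mono_mapP f lab; have := mono_mapP s lab.
  have := ltn_ord (s a); have := ltn_ord (s b).
  by case: (e); case: eqP; case: eqP; lia.
pose K m z := projT1 (cid (ex m z)).
have KE m z := projT2 (cid (ex m z)) : forall a, K m z a = _ :> nat.
have K_act l m (g : mono_map l m) z : K l (act g z) = mono_comp (K m z) g.
  by apply: mono_ext => a; apply: ord_inj; rewrite mono_compE !KE /= !mono_compE.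
exists (@SimplicialMap (cylinder (std_simplex n)) (std_simplex n) K K_act).
by move=> m f s a; rewrite /= KE.
Qed.

Variables (e : bool) (A Z Z' E F : simplicial_set) (i : simplicial_map A Z)
  (b : simplicial_map Z' Z) (p : simplicial_map E F).
Hypothesis i_ext : has_section_extensions e i.
Hypothesis b_fib : @efib (~~ e) Z' Z b.
Hypothesis p_fib : @efib e E F p.

(** The deformation of an [n]-simplex of [Z] into its horn is the identity at
    the end [~~ e] of the interval, the one from which [b] lifts homotopies;
    hence it lifts to the pullback of [b]. *)
Lemma base_change_extends (v : simplicial_map (isoCylinder Z') F)
    (G : partial_map p v) (K : forall n, freeIso n -> Prop) :
  (forall m n (f : mono_map m n) j, K n j -> K m (act f j)) ->
  (forall n (x : isoCylinder Z' n), dom G x <->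
     K n x.2 \/ exists a, i n a = b n x.1) ->
  extends G.
Proof.
move=> K_act domG.
apply: (@dependent_lift A Z (isoCylinder Z') E F i
  (simplicial_comp b (fst_map _ _)) p v (fun n x => K n x.2) G _ _ e) => //.
  by move=> m n f x; apply: K_act.
move=> n k z n_gt0 kP.
pose T := pullback (simplicial_comp b (fst_map Z' freeIso)) (yoneda z).
have [R RE] := simplex_homotopy e k.
pose RT : simplicial_map (cylinder T) (std_simplex n) :=
  simplicial_comp R (prod_map
    (simplicial_comp (pullback_snd _ _) (fst_map _ _)) (snd_map _ _)).
have R0 m (f : mono_map m n) s : constant_at (~~ e) s -> R m (f, s) = f.
  move=> cs; apply: mono_ext => a; apply: ord_inj; rewrite RE cs.
  by case: (e).
(* The lift along [b] of the deformation [RT] is prescribed at the end [~~ e], where [RT] is the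
   projection. *)
unshelve refine (let GT : partial_map b (simplicial_comp (yoneda z) RT) :=
  @PartialMap (cylinder T) Z' Z b (simplicial_comp (yoneda z) RT)
  (fun m x y => constant_at (~~ e) x.2 /\ y = (sval x.1).1.1) _ _ _ in _).
- by move=> l m g [t s] y [cs ->]; split=> //; apply: constant_at_act.
- by move=> m x y y' [_ ->] [_ ->].
- by move=> m [[[q f] tP] s] y [cs ->]; rewrite /= R0 //; apply: tP.
have [|L [bL LG]] := @cylinder_lifts (~~ e) _ _ b T (fun _ _ => False) b_fib _ GT.
  move=> m x; split=> [[y [cs _]]|[//|cs]]; first by right.
  by exists (sval x.1).1.1.
have HP m (x : cylinder T m) : b m (L m x) = yoneda z m (RT m x) by apply: bL.
(* The [freeIso] coordinate does not move, so the part given by [K] is preserved. *)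
unshelve refine (let H : simplicial_map (cylinder T) T :=
  @SimplicialMap (cylinder T) T (fun m x =>
    exist _ ((L m x, (sval x.1).1.2), RT m x) (HP m x)) _ in _).
  by move=> l m g x; apply: eq_exist; rewrite -[RHS]/(_, _) !smap_act.
apply: (@retract_lifts e E F p T _ H) => //.
- move=> m [[[q j] f] tP]; apply: eq_exist => /=.
  have cs : constant_at (~~ e) (const1 (~~ e) m) by move=> a; rewrite const1E.
  rewrite R0 //; congr (_, _, _); first by apply: LG; split.
- move=> m [[q f] tP] s cs /=; right; apply/in_hornE.
  exists (if e then 0 else n); first by case: (e).
  split=> [|a]; first by case: (e) kP; lia.
  rewrite RE cs eqxx; have := ltn_ord k; case: (e) kP; lia.
- move=> m [[q f] tP] s /= [Kq|/in_hornE[j lj [njk aj]]]; first by left.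
  right; apply/in_hornE; exists j => //; split=> // a.
  by rewrite RE; have := aj a; case: eqP; case: (e); lia.
Qed.

End BaseChange.

(** The map [t] is a section of [d] only after composition with [pi]. As [pi] is trivial, [d t] is
    joined to the identity over [B], and transport of [t] along this homotopy yields a true
    section. *)
Lemma section_extensions_of_trivial e (A Z B : simplicial_set)
    (i : simplicial_map A Z) (pi : simplicial_map Z B) :
  (forall (T : simplicial_set) (S : forall n, T n -> Prop), lifts pi S) ->
  (forall (D : simplicial_set) (d : simplicial_map D Z) (a : simplicial_map A D),
    @efib e D Z d -> (forall n x, d n (a n x) = i n x) ->
    exists t : simplicial_map Z D,
      (forall n z, pi n (d n (t n z)) = pi n z) /\
      (forall n x, t n (i n x) = a n x)) ->
  has_section_extensions e i.
Proof.
move=> pi_triv ext D d a fd da.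
have [t [pdt ti]] := ext D d a fd da.
have dti n x : d n (t n (i n x)) = i n x by rewrite ti da.
pose I n (z : Z n) := exists x, i n x = z.
have I_act m n (f : mono_map m n) z : I n z -> I m (act f z).
  by case=> x <-; exists (act f x); rewrite smap_act.
(* A homotopy over [B], relative to [A], from [d t] to the identity of [Z]. *)
unshelve refine (let G : partial_map pi (simplicial_comp pi (fst_map Z freeIso)) :=
  @PartialMap (isoCylinder Z) Z B pi (simplicial_comp pi (fst_map Z freeIso))
  (fun n x z => (x.2 = object true n \/ I n x.1) /\ z = x.1 \/
     x.2 = object false n /\ z = d n (t n x.1)) _ _ _ in _).
- move=> m n f [x j] z /= [[[->|Ix] ->]|[-> ->]]; [left|left|right].
  + by split=> //; left.
  + by split=> //; right; apply: I_act.
  + by rewrite !smap_act.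
- move=> n [x j] z z' /= [[Ix ->]|[-> ->]] [[Ix' ->]|[ej ->]] //.
    case: Ix => [|[y <-]]; last by rewrite dti.
    by rewrite ej => /esym/object_neq.
  by case: Ix' => [/esym/object_neq//|[y <-]]; rewrite dti.
- by move=> n [x j] z /= [[_ ->]|[_ ->]].
have [//|h [ph hG]] := pi_triv _ (fun n (x : isoCylinder Z n) => dom G x) _ G.
(* It lifts along [d], starting from [t] and constant on [A]. *)
unshelve refine (let G' : partial_map d h :=
  @PartialMap (isoCylinder Z) D Z d h
  (fun n x y => (I n x.1 \/ x.2 = object false n) /\ y = t n x.1) _ _ _ in _).
- move=> m n f [x j] y /= [Ix ->]; rewrite smap_act; split=> //.
  by case: Ix => [Ix|->]; [left; exact (I_act _ _ _ _ Ix)|right].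
- by move=> n x y y' [_ ->] [_ ->].
- move=> n [x j] y /= [Ix ->]; apply: esym; apply: hG => /=.
  case: Ix => [Ix|->]; last by right.
  by left; split; [right|case: Ix => y' <-; rewrite dti].
have [|H [dH HG]] := @object_start_lifts e Z D Z d I fd _ G'.
  by move=> n x; split=> [[y []]//|Ix]; exists (t n x.1).
exists (simplicial_comp H (cylinder_end true Z)); split=> n x /=.
  by rewrite dH; refine (hG _ _ _ _); left; split=> //; left.
by rewrite -ti; apply: HG; split=> //; left; exists x.
Qed.

(** * Model structures on the slices *)

Section CategoryLemmas.

Variable C : category.

Lemma rlp_comp (A B X Y Z : C) (i : hom A B) (p : hom X Y) (q : hom Y Z) :
  rlp i p -> rlp i q -> rlp i (q ∘ p).
Proof.
move=> ip iq u v sq; have [|h [hi qh]] := iq (p ∘ u) v.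
  by rewrite comp_assoc.
have [|k [ki pk]] := ip u h; first by rewrite hi.
by exists k; rewrite -comp_assoc pk.
Qed.

Lemma rlp_cartesian (A B P X Y Z : C) (i : hom A B)
    (g' : hom P X) (f' : hom P Y) (f : hom X Z) (g : hom Y Z) :
  cartesian g' f' f g -> rlp i f -> rlp i f'.
Proof.
move=> [sq univ] fi u v uv.
have [|h [hi fh]] := fi (g' ∘ u) (g ∘ v).
  by rewrite comp_assoc sq -comp_assoc uv comp_assoc.
have [k [[g'k f'k] _]] := univ _ h v fh.
exists k; split=> //.
have [|l [_ luniq]] := univ _ (g' ∘ u) (f' ∘ u).
  by rewrite !comp_assoc sq.
rewrite [RHS]luniq // [LHS]luniq // comp_assoc; first by rewrite g'k.
by rewrite f'k uv.
Qed.

Lemma cartesian_sym (P X Y Z : C)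
    (g' : hom P X) (f' : hom P Y) (f : hom X Z) (g : hom Y Z) :
  cartesian g' f' f g -> cartesian f' g' g f.
Proof.
move=> [sq univ]; split=> // T a b ab.
have [h [[hb ha] huniq]] := univ T b a (esym ab).
by exists h; split=> // h' h'a h'b; apply: huniq.
Qed.

Lemma terminal_eq (X T : C) (f g : hom X T) : is_terminal T -> f = g.
Proof. by move=> /(_ X)[t tU]; rewrite (tU f) (tU g). Qed.

Variable M : model_structure C.

(** The retract argument: [p] lifts against the first factor of its own factorization, hence is a
    retract of the second. *)
Lemma fib_of_rlp (X Y : C) (p : hom X Y) :
  (forall (A B : C) (i : hom A B), cof M i -> weq M i -> rlp i p) -> fib M p.
Proof.
move=> pr; have [Z [i [q [ci wi fq qi]]]] := factor_tcof_fib M p.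
have [|r [ri pr']] := pr _ _ i ci wi (idm X) q; first by rewrite comp_idr qi.
apply: (fib_retract _ fq); exists i, r, (idm Y), (idm Y).
by split; rewrite ?comp_idl.
Qed.

Lemma weq_of_rlp (X Y : C) (p : hom X Y) :
  (forall (A B : C) (i : hom A B), cof M i -> rlp i p) -> weq M p.
Proof.
move=> pr; have [Z [i [q [ci fq wq qi]]]] := factor_cof_tfib M p.
have [|r [ri pr']] := pr _ _ i ci (idm X) q; first by rewrite comp_idr qi.
apply: (weq_retract _ wq); exists i, r, (idm Y), (idm Y).
by split; rewrite ?comp_idl.
Qed.

Lemma weq_id (X : C) : weq M (idm X).
Proof.
apply: weq_of_rlp => A B i _ u v uv.
by exists v; rewrite -uv !comp_idl.
Qed.

Lemma fib_comp (X Y Z : C) (p : hom X Y) (q : hom Y Z) :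
  fib M p -> fib M q -> fib M (q ∘ p).
Proof.
move=> fp fq; apply: fib_of_rlp => A B i ci wi.
by apply: rlp_comp; [apply: lift_tcof_fib fp|apply: lift_tcof_fib fq].
Qed.

Lemma fibrant_of_fib (X T : C) (f : hom X T) :
  is_terminal T -> fib M f -> fibrant M X.
Proof.
move=> tT ff T' f' tT'; apply: (fib_retract _ ff).
have [r' _] := tT' T; have [s' _] := tT T'.
exists (idm X), (idm X), s', r'.
by split; rewrite ?comp_idl //; apply: terminal_eq.
Qed.

End CategoryLemmas.

(** * Trivial fibrations and pullbacks of simplicial sets *)

Section TrivialFibrations.

Lemma efib_comp e (X Y Z : sSet) (p : hom X Y) (q : hom Y Z) :
  efib e p -> efib e q -> efib e (q ∘ p).
Proof. by move=> fp fq n k n0 kP; apply: rlp_comp; [apply: fp|apply: fq]. Qed.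

Lemma efib_cartesian e (P X Y Z : sSet)
    (g' : hom P X) (f' : hom P Y) (f : hom X Z) (g : hom Y Z) :
  cartesian g' f' f g -> efib e f -> efib e f'.
Proof. by move=> c ff n k n0 kP; apply: (rlp_cartesian c); apply: ff. Qed.

Lemma smap_eq (X Y : sSet) (f g : hom X Y) :
  f = g -> forall n (x : simplex X n), smap f x = smap g x.
Proof. by move=> ->. Qed.

Lemma pullback_cartesian (X Y Z : sSet) (f : hom X Z) (g : hom Y Z) :
  @cartesian sSet (pullback f g) X Y Z (pullback_fst f g) (pullback_snd f g) f g.
Proof.
split; first by apply: simplicial_map_ext => n [[x y] xy].
move=> T a b ab.
have abE n t : f n (a n t) = g n (b n t).
  exact: (smap_eq ab t).
unshelve refine (let h : simplicial_map T (pullback f g) :=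
  @SimplicialMap T (pullback f g) (fun n t => exist _ (a n t, b n t) (abE n t)) _ in _).
  by move=> m n c t; apply: eq_exist; rewrite !smap_act.
exists h; split; first by split; apply: simplicial_map_ext.
move=> h' h'a h'b; apply: simplicial_map_ext => n t.
have := smap_eq h'a t.
have := smap_eq h'b t.
rewrite /=; case: (h' n t) => [[x y] xy] /= eb ea.
by apply: eq_exist; rewrite ea eb.
Qed.

(** The universal property is tested on standard simplices, by the Yoneda lemma. *)
Lemma cartesian_simplex (P X Y Z : sSet) (g' : hom P X) (f' : hom P Y)
    (f : hom X Z) (g : hom Y Z) : cartesian g' f' f g ->
  (forall n (x : simplex X n) (y : simplex Y n), smap f x = smap g y ->
    exists t, smap g' t = x /\ smap f' t = y) /\
  (forall n (t t' : simplex P n),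
    smap g' t = smap g' t' -> smap f' t = smap f' t' -> t = t').
Proof.
move=> [sq univ]; split=> [n x y xy|n t t' eg ef].
  have [|h [[ha hb] _]] := univ (std_simplex n) (yoneda x) (yoneda y).
    by apply: simplicial_map_ext => m c /=; rewrite !smap_act xy.
  exists (smap h (mono_id n)); split.
    have := smap_eq ha (mono_id n).
    by rewrite /= act_id.
  have := smap_eq hb (mono_id n).
  by rewrite /= act_id.
have [|h [_ hU]] := univ (std_simplex n) (g' ∘ yoneda t') (f' ∘ yoneda t').
  by rewrite !comp_assoc sq.
suff ett : yoneda t = yoneda t'.
  by have := smap_eq ett (mono_id n); rewrite /= !act_id.
rewrite [RHS]hU // [LHS]hU //.
  by apply: simplicial_map_ext => m c /=; rewrite !smap_act eg.
by apply: simplicial_map_ext => m c /=; rewrite !smap_act ef.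
Qed.

Definition trivial_fibration (X Y : sSet) (p : hom X Y) : Prop :=
  forall (A B : sSet) (i : hom A B), (forall n, injective (@smap _ _ i n)) ->
  rlp i p.

Lemma trivial_fibration_lifts (X Y : sSet) (p : hom X Y)
    (T : simplicial_set) (S : forall n, T n -> Prop) :
  trivial_fibration p -> lifts p S.
Proof.
move=> tp v G dG.
have S_act m n (f : mono_map m n) x : S n x -> S m (act f x).
  by move=> /dG/(dom_act f)/dG.
pose i : simplicial_map (sub_set S_act) T := @SimplicialMap (sub_set S_act) T
  (fun n x => sval x) (fun _ _ _ _ => erefl).
apply: (@rlp_lifts _ _ p _ _ i S _ _ v G dG).
  by apply: tp => n [x Sx] [y Sy] /= xy; apply: eq_exist.
move=> n x; split=> [Sx|[[y Sy] /= <- //]].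
by exists (exist _ x Sx).
Qed.

(** A simplex of [freeIso] is an arbitrary choice of vertices, so a map to it extends by any values,
    here [false], at vertices outside the image of [i]. *)
Lemma isoCylinder_trivial (X : sSet) :
  @trivial_fibration (isoCylinder X) X (fst_map X freeIso).
Proof.
move=> A B i i_inj u v uv.
pose c (y : simplex B 0) : bool :=
  `[< exists2 a : simplex A 0, smap i a = y & (smap u a).2 ord0 = true >].
have vertexE n (j : 'I_n.+1) : exists d : mono_map 0 n, forall a, d a = j.
  by exists (mono_const 0 j) => a; rewrite mk_monoE.
unshelve refine (let h : simplicial_map B (isoCylinder X) :=
  @SimplicialMap B (isoCylinder X)
  (fun n y => (smap v y, fun j => c (act (mono_const 0 j) y))) _ in _).
  move=> m n f y; rewrite /= smap_act; congr pair.
  apply: funext => j; congr c; rewrite -act_comp; congr act.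
  by apply: mono_ext => a; rewrite mono_compE !mk_monoE.
exists h; split; apply: simplicial_map_ext => n x //=.
have := smap_eq uv x => /= uvx.
rewrite -uvx; case ux: (smap u x) => [x0 s] /=; congr pair.
apply: funext => j.
have uxj : (smap u (act (mono_const 0 j) x)).2 ord0 = s j.
  by rewrite smap_act ux /= mk_monoE.
rewrite -smap_act -uxj /c; apply/asboolP/idP => [[a /i_inj -> //]|sj].
by exists (act (mono_const 0 j) x).
Qed.

End TrivialFibrations.

Section SliceModels.

Variables (e : bool) (M : forall A : sSet, model_structure (slice A)).
Hypothesis M_cof : forall (A : sSet) (X Y : slice A) (f : hom X Y),
  cof (M A) f <-> monic f.
Hypothesis M_fibrant : forall (A : sSet) (X : slice A),
  fibrant (M A) X <-> efib e (proj X).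

(** Two simplices with the same image under [f] have the same projection to [A], so they are
    parallel maps over [A] from a standard simplex. *)
Lemma monic_injective (A : sSet) (X Y : slice A) (f : hom X Y) :
  monic f <-> forall n, injective (@smap _ _ (slice_map f) n).
Proof.
split=> [mf n x x' fxx'|inj Z g h gh]; last first.
  apply: slice_hom_ext; apply: simplicial_map_ext => n z; apply: inj.
  exact: (smap_eq (congr1 (@slice_map _ _ _ _) gh) z).
have px t : smap (proj X) t = smap (proj Y) (smap (slice_map f) t).
  exact: (esym (smap_eq (slice_mapP f) t)).
pose yo t : @hom sSet (std_simplex n) (total X) := yoneda t.
have ex : proj X ∘ yo x' = proj X ∘ yo x.
  by apply: simplicial_map_ext => m c /=; rewrite !smap_act !px fxx'.
pose Z : slice A := SliceOb (proj X ∘ yo x).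
pose g : hom Z X := @SliceHom sSet A Z X (yo x) erefl.
pose h : hom Z X := @SliceHom sSet A Z X (yo x') ex.
have gh : g = h.
  apply: mf; apply: slice_hom_ext; apply: simplicial_map_ext => m c /=.
  by rewrite !smap_act fxx'.
have := smap_eq (congr1 (@slice_map _ _ _ _) gh) (mono_id n).
by rewrite /= !act_id.
Qed.

Lemma slice_rlp (A : sSet) (K L X Y : slice A) (i : hom K L) (p : hom X Y) :
  rlp (slice_map i) (slice_map p) -> rlp i p.
Proof.
move=> ip u v uv.
have [|h [hi ph]] := ip (slice_map u) (slice_map v).
  exact: (congr1 (@slice_map _ _ _ _) uv).
have hP : proj X ∘ h = proj L.
  by rewrite -(slice_mapP p) -comp_assoc ph (slice_mapP v).
by exists (SliceHom hP); split; apply: slice_hom_ext.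
Qed.

Lemma trivial_fibration_weq (A : sSet) (X Y : slice A) (p : hom X Y) :
  trivial_fibration (slice_map p) -> weq (M A) p.
Proof.
move=> tp; apply: weq_of_rlp => K L i /M_cof/monic_injective mi.
by apply: slice_rlp; apply: tp.
Qed.

Section Homotopies.

Variable A : sSet.
Implicit Types X Y : slice A.

Definition slice_cylinder X : slice A :=
  @SliceOb sSet A (isoCylinder (total X))
    (@comp sSet _ _ _ (proj X) (fst_map (total X) freeIso)).

Definition slice_end (c : bool) X : hom X (slice_cylinder X).
Proof.
refine (@SliceHom sSet A X (slice_cylinder X) (cylinder_end c (total X)) _).
by apply: simplicial_map_ext.
Defined.

Definition slice_collapse X : hom (slice_cylinder X) X :=
  @SliceHom sSet A (slice_cylinder X) X (fst_map (total X) freeIso) erefl.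

Lemma slice_end_collapse c X : slice_collapse X ∘ slice_end c X = idm X.
Proof. by apply: slice_hom_ext; apply: simplicial_map_ext. Qed.

(** The ends are sections of the collapse, a trivial fibration. *)
Lemma slice_end_weq c X : weq (M A) (slice_end c X).
Proof.
apply: (@weq_cancel_l _ _ _ _ _ _ (slice_collapse X)).
  by apply: trivial_fibration_weq; apply: isoCylinder_trivial.
by rewrite slice_end_collapse; apply: weq_id.
Qed.

Lemma slice_end_cof c X : cof (M A) (slice_end c X).
Proof. by apply/M_cof/monic_injective => n x y []. Qed.

Lemma homotopic_weq c c' X Y (H : hom (slice_cylinder X) Y) :
  weq (M A) (H ∘ slice_end c X) -> weq (M A) (H ∘ slice_end c' X).
Proof.
move=> w; apply: weq_comp; first exact: slice_end_weq.
exact: (weq_cancel_r (slice_end_weq c X) w).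
Qed.

Definition slice_cylinder_map X Y (f : hom X Y) :
  hom (slice_cylinder X) (slice_cylinder Y).
Proof.
refine (@SliceHom sSet A (slice_cylinder X) (slice_cylinder Y)
  (prod_map (simplicial_comp (slice_map f) (fst_map _ _)) (snd_map _ _)) _).
apply: simplicial_map_ext => n x.
exact: (smap_eq (slice_mapP f) x.1).
Defined.

Lemma slice_end_natural c X Y (f : hom X Y) :
  slice_cylinder_map f ∘ slice_end c X = slice_end c Y ∘ f.
Proof. by apply: slice_hom_ext; apply: simplicial_map_ext. Qed.

(** Extending along [j] and joining two extensions by a homotopy is all that
    is needed for [j] to be invertible up to homotopy. *)
Lemma weq_of_extensions (U V : slice A) (j : hom U V) :
  (forall W (g0 : hom U W), fibrant (M A) W -> exists g : hom V W, g ∘ j = g0) ->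
  (forall W (f0 f1 : hom V W), fibrant (M A) W -> f0 ∘ j = f1 ∘ j ->
    exists h : hom (slice_cylinder V) W,
      h ∘ slice_end false V = f0 /\ h ∘ slice_end true V = f1) ->
  weq (M A) j.
Proof.
move=> ext hext.
pose T : slice A := SliceOb (idm A).
have tT : is_terminal T by apply: slice_terminal.
have [tV _] := tT V.
(* [R] and [U'] are fibrant replacements of [V] and [U], with a fibration [f] between them. *)
have [R [r [rho [cr wr frho _]]]] := factor_tcof_fib (M A) tV.
have fR : fibrant (M A) R by apply: fibrant_of_fib frho.
have [U' [k [f [ck wk ff fk]]]] := factor_tcof_fib (M A) (r ∘ j).
have fU' : fibrant (M A) U'.
  by apply: (@fibrant_of_fib _ (M A) U' T (rho ∘ f)) => //; apply: fib_comp.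
have [g gj] := ext U' k fU'.
have [|h [h0 h1]] := hext R (f ∘ g) r fR.
  by rewrite -comp_assoc gj fk.
(* The homotopy from [f g] to [r] lifts to one from [g] to a map strictly over [r]; extended along
   [r], this map becomes a section [s] of [f]. *)
have [|H [H0 fH]] := lift_tcof_fib (slice_end_cof false V)
  (slice_end_weq false V) ff (u := g) (v := h).
  by rewrite h0.
have [|s [sr fs]] := lift_tcof_fib cr wr ff (u := H ∘ slice_end true V) (v := idm R).
  by rewrite comp_assoc fH h1 comp_idl.
(* [s f k] is homotopic to [g j = k], so [s f] is a weak equivalence; [f], having the section [s],
   is a retract of it. *)
have wsf : weq (M A) (s ∘ f).
  apply: (weq_cancel_r wk); rewrite -comp_assoc fk comp_assoc sr.
  rewrite -comp_assoc -slice_end_natural comp_assoc.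
  apply: (@homotopic_weq false); rewrite -comp_assoc slice_end_natural.
  by rewrite comp_assoc H0 gj.
have wf : weq (M A) f.
  apply: (weq_retract _ wsf); exists (idm U'), (idm U'), s, f.
  by split; rewrite ?comp_idl ?comp_idr // comp_assoc fs comp_idl.
apply: (weq_cancel_l wr); rewrite -fk; exact: weq_comp.
Qed.

End Homotopies.

(** For [RFib] and [LFib] in place of [M] these are the final and the initial maps. *)
Definition universal_weq (X Y : sSet) (f : hom X Y) : Prop :=
  forall (A : sSet) (q : hom Y A), weq (M A) (map_over f q).

Lemma universal_weq_over (X Y A : sSet) (f : hom X Y) (qX : hom X A)
    (qY : hom Y A) (eq : qY ∘ f = qX) : universal_weq f ->
  weq (M A) (@SliceHom sSet A (SliceOb qX) (SliceOb qY) f eq).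
Proof. by move=> wf; case: _ / eq; apply: wf. Qed.

Lemma universal_weq_comp (X Y Z : sSet) (f : hom X Y) (g : hom Y Z) :
  universal_weq f -> universal_weq g -> universal_weq (g ∘ f).
Proof.
move=> wf wg A q.
have eq : (q ∘ g) ∘ f = q ∘ (g ∘ f) by rewrite comp_assoc.
have := weq_comp (universal_weq_over eq wf) (wg A q).
by congr (weq _ _); apply: slice_hom_ext.
Qed.

Lemma trivial_fibration_universal_weq (X Y : sSet) (p : hom X Y) :
  trivial_fibration p -> universal_weq p.
Proof. by move=> tp A q; apply: trivial_fibration_weq. Qed.

Lemma universal_weq_factor (A B : sSet) (v : hom A B) : universal_weq v ->
  exists (Z : sSet) (i : hom A Z) (pi : hom Z B),
    [/\ pi ∘ i = v, trivial_fibration pi, forall n, injective (@smap _ _ i n) &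
        has_section_extensions e i].
Proof.
move=> wv.
have [Z [i [p [ci wi fp pi]]]] := factor_tcof_fib (M B) (map_over v (idm B)).
have wp : weq (M B) p.
  by apply: (weq_cancel_r wi); rewrite pi; apply: wv.
have tT := @slice_terminal sSet B.
have pE : slice_map p = proj Z by rewrite -(slice_mapP p) comp_idl.
(* A lifting problem in simplicial sets is one over [B], with structure maps given by its base
   [w]. *)
have tp : trivial_fibration (slice_map p).
  move=> K L k k_inj u w uw.
  pose Ls : slice B := SliceOb w.
  pose Ks : slice B := SliceOb (w ∘ k).
  pose ks : hom Ks Ls := map_over k w.
  have uP : proj Z ∘ u = w ∘ k by rewrite -uw pE.
  pose us : hom Ks Z := @SliceHom sSet B Ks Z u uP.
  pose ws : hom Ls (SliceOb (idm B)) :=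
    @SliceHom sSet B Ls (SliceOb (idm B)) w (comp_idl w).
  have ck : cof (M B) ks by apply/M_cof/monic_injective.
  have [|h [hk ph]] := lift_cof_tfib ck fp wp (u := us) (v := ws).
    exact: terminal_eq.
  exists (slice_map h); split.
    exact: (congr1 (@slice_map _ _ _ _) hk).
  exact: (congr1 (@slice_map _ _ _ _) ph).
exists (total Z), (slice_map i), (slice_map p); split=> //.
- exact: (congr1 (@slice_map _ _ _ _) pi).
- exact: ((monic_injective i).1 ((M_cof i).1 ci)).
apply: (@section_extensions_of_trivial e _ _ _ _ (slice_map p)).
  by move=> T S; apply: trivial_fibration_lifts.
move=> D d a fd da.
(* Only the fibrancy of [D] over [B] is used, which follows from that of [Z]; so the extension [t]
   of [a] is a map over [B] and not yet a section. *)
pose Ds : slice B := @SliceOb sSet B D (@comp sSet _ _ _ (proj Z) d).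
have fZ : efib e (proj Z) by apply/M_fibrant; apply: fibrant_of_fib fp.
have fD : fibrant (M B) Ds by apply/M_fibrant; apply: efib_comp.
have [tD _] := tT Ds.
have aP : proj Ds ∘ a = idm B ∘ v.
  apply: etrans (slice_mapP i); apply: simplicial_map_ext => n x /=.
  by rewrite da.
pose as_ : hom (SliceOb (idm B ∘ v) : slice B) Ds :=
  @SliceHom sSet B (SliceOb (idm B ∘ v)) Ds a aP.
have [|t [ti pt]] := lift_tcof_fib ci wi (fD _ tD tT) (u := as_) (v := p).
  exact: terminal_eq.
exists (slice_map t); split=> n x.
  rewrite pE.
  exact: (smap_eq (slice_mapP t) x).
exact: (smap_eq (congr1 (@slice_map _ _ _ _) ti) x).
Qed.

(** Here [A'] is the preimage under [b] of the image of [i]. Both requirements of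
    [weq_of_extensions] come from [base_change_extends]: with [K] empty for maps, read off at the
    end [true], and with [K] the two ends for homotopies. *)
Lemma base_change_universal_weq (A Z A' Z' : sSet) (i : hom A Z)
    (b : hom Z' Z) (j : hom A' Z') :
  has_section_extensions e i -> efib (~~ e) b ->
  (forall n, injective (@smap _ _ j n)) ->
  (forall n (z : simplex Z' n),
    (exists a, smap j a = z) <-> exists a, smap i a = smap b z) ->
  universal_weq j.
Proof.
move=> iext fb j_inj jE C q; apply: weq_of_extensions.
- move=> W g0 /M_fibrant fW.
  pose v : simplicial_map (isoCylinder Z') C := simplicial_comp q (fst_map Z' freeIso).
  unshelve refine (let G : partial_map (proj W) v :=
    @PartialMap (isoCylinder Z') (total W) C (proj W) v
    (fun n x y => exists2 a, smap j a = x.1 & smap (slice_map g0) a = y) _ _ _ in _).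
  + move=> m n f x y /= [a ja <-]; exists (act f a); first by rewrite smap_act ja.
    by rewrite smap_act.
  + move=> n x y y' [a ja <-] [a' ja' <-]; congr smap; apply: j_inj.
    by rewrite ja ja'.
  + move=> n x y [a ja <-]; rewrite /= -ja.
    exact: (smap_eq (slice_mapP g0) a).
  have [||g [qg gG]] := base_change_extends iext fb fW (G := G)
    (K := fun _ _ => False) => //.
    move=> n x; rewrite -jE; split=> [[y [a ja _]]|[//|[a ja]]].
      by right; exists a.
    by exists (smap (slice_map g0) a); exists a.
  unshelve eexists (@SliceHom sSet C (SliceOb q) W
    (simplicial_comp g (cylinder_end true Z')) _).
    by apply: simplicial_map_ext => n x; apply: qg.
  apply: slice_hom_ext; apply: simplicial_map_ext => n a.
  by apply: gG; exists a.
- move=> W f0 f1 /M_fibrant fW f01.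
  have {}f01 n (a : simplex A' n) :
      smap (slice_map f0) (smap j a) = smap (slice_map f1) (smap j a).
    exact: (smap_eq (congr1 (@slice_map _ _ _ _) f01) a).
  have fP (f : slice_hom (SliceOb q) W) n (x : simplex Z' n) :
      smap (proj W) (smap (slice_map f) x) = smap q x.
    exact: (smap_eq (slice_mapP f) x).
  pose v : simplicial_map (isoCylinder Z') C := simplicial_comp q (fst_map Z' freeIso).
  (* The homotopy is prescribed as [f0] and [f1] at the ends and as their common value over the
     image of [j]. *)
  unshelve refine (let G : partial_map (proj W) v :=
    @PartialMap (isoCylinder Z') (total W) C (proj W) v
    (fun n x y =>
       (x.2 = object true n \/ exists a, smap j a = x.1) /\
         y = smap (slice_map f1) x.1 \/
       x.2 = object false n /\ y = smap (slice_map f0) x.1) _ _ _ in _).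
  + move=> m n f [x c] y /= [[cx ->]|[-> ->]]; last first.
      by right; rewrite smap_act.
    left; rewrite smap_act; split=> //; case: cx => [->|[a <-]]; first by left.
    by right; exists (act f a); rewrite smap_act.
  + move=> n [x c] y y' /= [[cx ->]|[ec ->]] [[cx' ->]|[ec' ->]] //.
      case: cx => [|[a <-]]; last by rewrite f01.
      by rewrite ec' => /esym/object_neq.
    case: cx' => [|[a <-]]; last by rewrite f01.
    by rewrite ec => /esym/object_neq.
  + by move=> n [x c] y /= [[_ ->]|[_ ->]]; apply: fP.
  have [||h [qh hG]] := base_change_extends iext fb fW (G := G)
    (K := fun n c => c = object true n \/ c = object false n).
  + by move=> m n f c [->|->]; [left|right].
  + move=> n [x c]; rewrite -jE; split=> [[y /= [[[cx|jx] _]|[cx _]]]|/= [[cx|cx]|jx]].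
    * by left; left.
    * by right.
    * by left; right.
    * by exists (smap (slice_map f1) x); left; split=> //; left.
    * by exists (smap (slice_map f0) x); right.
    * by exists (smap (slice_map f1) x); left; split=> //; right.
  unshelve eexists (@SliceHom sSet C (slice_cylinder (SliceOb q)) W h _).
    by apply: simplicial_map_ext => n x; apply: qh.
  split; apply: slice_hom_ext; apply: simplicial_map_ext => n x; apply: hG.
    by right.
  by left; split=> //; left.
Qed.

(** With [v] factored as [pi] after [i], pulling [b] back along [pi] splits [w] into [j] followed by
    a base change of [pi]. The map [j] is the base change of [i] along a pullback of [b], again an
    [efib (~~ e)]. *)
Lemma universal_weq_base_change (A' B' A B : sSet) (w : hom A' B')
    (a : hom A' A) (b : hom B' B) (v : hom A B) :
  cartesian w a b v -> efib (~~ e) b -> universal_weq v -> universal_weq w.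
Proof.
move=> cart fb /universal_weq_factor[Z [i [pi [piE tpi i_inj iext]]]].
have [lift uniq] := cartesian_simplex cart.
have c := pullback_cartesian b pi.
have [|j [[jw jia] _]] := c.2 A' w (i ∘ a).
  by rewrite cart.1 -piE comp_assoc.
have jwE n (x : simplex A' n) : (sval (smap j x)).1 = smap w x.
  exact: (smap_eq jw x).
have jiaE n (x : simplex A' n) : (sval (smap j x)).2 = smap i (smap a x).
  exact: (smap_eq jia x).
rewrite -jw; apply: universal_weq_comp; last first.
  apply: trivial_fibration_universal_weq => K L k k_inj.
  exact: (rlp_cartesian (cartesian_sym c) (tpi _ _ _ k_inj)).
apply: (base_change_universal_weq iext (efib_cartesian c fb)) => n.
  move=> x y exy; apply: uniq; first by rewrite -!jwE exy.
  by apply: i_inj; rewrite -!jiaE exy.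
move=> [[y z] yz]; split=> [[x jx]|/= [x ix]].
  by exists (smap a x); rewrite /= -jiaE jx.
have [|t [wt at_]] := lift n y x.
  by rewrite -piE /= ix; apply: yz.
exists t; move: (jwE n t) (jiaE n t); case: (smap j t) => [[y' z'] yz'] /= ey ez.
by apply: eq_exist; rewrite ey ez wt at_ ix.
Qed.

End SliceModels.

Theorem proposition4p12
    (RFib : forall A : ob sSet, contravariant_model A)
    (LFib : forall A : ob sSet, covariant_model A) :
  (forall (X Y : ob sSet) (p : hom X Y), left_fibration p -> proper RFib p) /\
  (forall (X Y : ob sSet) (p : hom X Y), right_fibration p -> smooth LFib p).
Proof.
split=> X Y p fp A' B' A B w x a b v y cwv cxy.
  (* [efib true] and [efib false] are convertible with [right_fibration] and [left_fibration], and
     [universal_weq] with [final] and [initial]. *)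
  apply: (@universal_weq_base_change true RFib (fun A => @contra_cof A (RFib A))
    (fun A => @contra_fibrant A (RFib A)) _ _ _ _ _ _ _ _ cwv).
  exact: (@efib_cartesian false _ _ _ _ _ _ _ _ cxy fp).
apply: (@universal_weq_base_change false LFib (fun A => @cov_cof A (LFib A))
  (fun A => @cov_fibrant A (LFib A)) _ _ _ _ _ _ _ _ cwv).
exact: (@efib_cartesian true _ _ _ _ _ _ _ _ cxy fp).
Qed.
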